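(* Let $a$ be a strongly regular scale factor (extended evenly to negative arguments) such that there is a constant $C>0$ with $\left|\frac{\dddot a(t)a^2(t)}{\dot a^3(t)}\right|\le C$ for all $t>0$, and suppose that either (i) $\dot a(0^+)=0$ and there is $\epsilon>0$ with $\ddot a(t)\ge0$ on $(0,\epsilon)$, or (ii) $\infty>\dot a(0^+)>0$. Then the partial derivative $\partial_\tau g_{\tau\tau}$ (which exists at every point of $D$) is continuous on $D$.
   Context: A function $a:[0,\infty)\to[0,\infty)$ is a regular scale factor if: (a) $a(0)=0$; (b) $a$ is increasing and continuous on $[0,\infty)$, twice continuously differentiable on $(0,\infty)$, with an inverse function on $[0,\infty)$; (c) $\frac{a(t)\ddot a(t)}{\dot a(t)^2}\le1$ for all $t>0$ (presupposing $\dot a(t)\ne0$). It is strongly regular if also $\frac{a\ddot a}{\dot a^2}\ge-K$ on $(0,\infty)$ for a constant $K\ge1$. $\dot a(0^+)=\lim_{t\to0^+}\dot a(t)$. Extend $a$ by $a(-t)=a(t)$. For $\tau>0$, $\rho_{\mathcal M_\tau}=\int_0^\tau\frac{a(t)}{\sqrt{a^2(\tau)-a^2(t)}}dt$ and $D=\{(\tau,\rho):\tau>0,\ 0<\rho<2\rho_{\mathcal M_\tau}\}$. For $(\tau,\rho)\in D$, $t_0(\tau,\rho)$ is the unique $t_0\in(-\tau,\tau)$ with $\rho=\int_{t_0}^\tau\frac{a(t)}{\sqrt{a^2(\tau)-a^2(t)}}dt$. For $0\le t_0<\tau$, $f(\tau,t_0)=\int_{t_0}^{\tau}\frac{\ddot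 a(t)}{\dot a(t)^2}\left(\frac{\sqrt{a^2(\tau)-a^2(t_0)}}{\sqrt{a^2(\tau)-a^2(t)}}-1\right)dt$; for $-\tau<t_0<0$, $f(\tau,t_0)=2f(\tau,0)-f(\tau,-t_0)$. Finally $g_{\tau\tau}(\tau,\rho)=-[1-\dot a(\tau)f(\tau,t_0(\tau,\rho))]^2$ on $D$. *)

(* Defs.v *)
From Stdlib Require Import Reals Lra ClassicalEpsilon.
From Coquelicot Require Import Coquelicot.
Open Scope R_scope.

(* Derivatives of the scale factor (only used at points t > 0). *)
Definition da (a : R -> R) : R -> R := Derive a.
Definition dda (a : R -> R) : R -> R := Derive (Derive a).
Definition ddda (a : R -> R) : R -> R := Derive (Derive (Derive a)).

Definition ae (a : R -> R) (t : R) : R := a (Rabs t).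

Definition iint (f : R -> R) (x y : R) : R := RInt_gen f (at_right x) (at_left y).

Definition regular_scale_factor (a : R -> R) : Prop :=
  a 0 = 0 /\
  (forall t, 0 <= t -> 0 <= a t) /\
  (forall s t, 0 <= s -> s < t -> a s < a t) /\
  (forall t, 0 <= t -> filterlim a (within (fun x => 0 <= x) (locally t)) (locally (a t))) /\
  (forall t, 0 < t -> ex_derive a t /\ ex_derive (da a) t /\ continuous (dda a) t) /\
  (forall y, 0 <= y -> exists t, 0 <= t /\ a t = y) /\
  (forall t, 0 < t -> da a t <> 0 /\ a t * dda a t / (da a t) ^ 2 <= 1).

Definition strongly_regular_scale_factor (a : R -> R) : Prop :=
  regular_scale_factor a /\
  exists K, 1 <= K /\ forall t, 0 < t -> - K <= a t * dda a t / (da a t) ^ 2.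

Definition rhoM (a : R -> R) (tau : R) : R :=
  iint (fun t => a t / sqrt (a tau ^ 2 - a t ^ 2)) 0 tau.

Definition inD (a : R -> R) (tau rho : R) : Prop :=
  0 < tau /\ 0 < rho /\ rho < 2 * rhoM a tau.

Definition rho_of (a : R -> R) (tau t0 : R) : R :=
  iint (fun t => ae a t / sqrt (a tau ^ 2 - ae a t ^ 2)) t0 tau.

(* t0(tau, rho): the (unique) t0 in (-tau, tau) with rho = rho_of a tau t0. *)
Definition t0 (a : R -> R) (tau rho : R) : R :=
  epsilon (inhabits 0) (fun s => - tau < s < tau /\ rho = rho_of a tau s).

Definition f_nonneg (a : R -> R) (tau s : R) : R :=
  iint (fun t => dda a t / (da a t) ^ 2 *
                 (sqrt (a tau ^ 2 - a s ^ 2) / sqrt (a tau ^ 2 - a t ^ 2) - 1)) s tau.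

Definition fF (a : R -> R) (tau s : R) : R :=
  if Rle_dec 0 s then f_nonneg a tau s
  else 2 * f_nonneg a tau 0 - f_nonneg a tau (- s).

Definition g_tautau (a : R -> R) (tau rho : R) : R :=
  - (1 - da a tau * fF a tau (t0 a tau rho)) ^ 2.

(* Main.v *)
(** Let b be the inverse of a, A = a(tau), and let w in (0, pi) be the angle with
    A cos w = a(t0) (odd extension of a).  Put phi(y) = |y| / a'(b|y|) and
    psi(y) = y phi'(y).  The substitution a(t) = A cos x gives
      rho = P(A, w) = int_0^w phi(A cos x) dx,    A dP/dA = J(A, w) = int_0^w psi(A cos x) dx,
    and integrating f by parts twice yields, for w <= pi/2,
      1 - a'(tau) f = G(A, w) = (cos w phi(A cos w) + sin w J(A, w)) / phi(A).
    For fixed A one has dG/dw = R dP/dw with R continuous up to w = pi/2, where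
    dP/dw = phi(A cos w) vanishes; continuity of R there is exactly the finiteness of
    a'(0+).  Hence along rho = const the derivative of G in A is G_A - R P_A.
    The third derivative of a is merely bounded, so dJ/dA is computed after an
    integration by parts which only leaves increments of the Lipschitz function psi. *)
Require Import Defs.
From Stdlib Require Import Reals Lra ClassicalEpsilon.
From Coquelicot Require Import Coquelicot.
Open Scope R_scope.

(** * Parametric integrals *)

(** At [t0 = 0] the slope [- P_A / P_w] of the level curve [P = rho] has vanishing denominator, so
    neither [t0] nor the angle need be differentiable in tau there. The angle is therefore never
    differentiated: only its continuity is used, and that follows from strict monotonicity of [P] in
    [w]. The angle removes the inverse square root singularity at [t = tau] and turns the moving
    endpoint into the fixed endpoint 0. The odd extension puts both signs of [t0] into the single
    interval [(0, PI)]; a change of sign becomes the reflection of [w] in [PI / 2], and the rule for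
    f at negative [t0] a continuously differentiable correction term. The derivative of psi may be
    discontinuous, and near 0 even unbounded when a'(0+) = 0 (for [a t = t ^ 2], psi is
    [sqrt y / 4]). Integration by parts against a primitive of psi resolves both: what is left is
    [psi x - c * psi (x * c)] with [c = cos t], which must be small only near [c = 1]. So psi is
    needed Lipschitz near [x > 0] and merely continuous elsewhere. *)

Ltac eqR := match goal with |- ?x = ?y => change (@eq R x y) end.

Lemma continuity_2d_pt_comp2 (f g h : R -> R -> R) (x y : R) :
  continuity_2d_pt f (g x y) (h x y) ->
  continuity_2d_pt g x y -> continuity_2d_pt h x y ->
  continuity_2d_pt (fun u v => f (g u v) (h u v)) x y.
Proof.
  intros Hf Hg Hh eps.
  destruct (Hf eps) as [d Hd].
  destruct (Hg d) as [d1 H1].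
  destruct (Hh d) as [d2 H2].
  exists (mkposreal (Rmin d1 d2) (Rmin_stable_in_posreal d1 d2)); simpl.
  intros u v Hu Hv.
  apply Hd; [apply H1 | apply H2]; eapply Rlt_le_trans; try eassumption;
    auto using Rmin_l, Rmin_r.
Qed.

Lemma continuity_2d_pt_comp1 (f : R -> R) (g : R -> R -> R) (x y : R) :
  continuous f (g x y) -> continuity_2d_pt g x y ->
  continuity_2d_pt (fun u v => f (g u v)) x y.
Proof.
  intros Hf Hg; apply continuity_1d_2d_pt_comp; [ | exact Hg].
  apply continuity_pt_filterlim, Hf.
Qed.

Lemma continuity_2d_pt_section (f : R -> R -> R) (x y : R) :
  continuity_2d_pt f x y -> continuous (f x) y.
Proof.
  intros H; apply filterlim_locally; intros eps.
  destruct (H eps) as [d Hd]; exists d; intros z Hz.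
  apply Hd; [ rewrite Rminus_eq_0, Rabs_R0; apply cond_pos | exact Hz].
Qed.

Lemma continuity_2d_pt_section_l (f : R -> R -> R) (x y : R) :
  continuity_2d_pt f x y -> continuous (fun u => f u y) x.
Proof.
  intros H; apply filterlim_locally; intros eps.
  destruct (H eps) as [d Hd]; exists d; intros z Hz.
  apply Hd; [ exact Hz | rewrite Rminus_eq_0, Rabs_R0; apply cond_pos].
Qed.

Lemma ex_RInt_interior (f : R -> R) (lo hi c y : R) :
  lo < c < hi -> lo < y < hi ->
  (forall z, lo < z < hi -> continuous f z) -> ex_RInt f c y.
Proof.
  intros Hc Hy Hf; apply (ex_RInt_continuous (V := R_CompleteNormedModule)).
  intros z; unfold Rmin, Rmax; destruct (Rle_dec c y); intros Hz; apply Hf; lra.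
Qed.

Lemma is_derive_RInt_interior (f : R -> R) (lo hi c y : R) :
  lo < c < hi -> lo < y < hi ->
  (forall z, lo < z < hi -> continuous f z) ->
  is_derive (fun z => RInt f c z) y (f y).
Proof.
  intros Hc Hy Hf.
  apply (is_derive_RInt f _ c y); [ | apply Hf; lra].
  assert (H : 0 < Rmin (y - lo) (hi - y)) by (apply Rmin_pos; lra).
  exists (mkposreal _ H); intros z Hz.
  unfold ball in Hz; simpl in Hz; unfold AbsRing_ball, abs, minus, plus, opp in Hz; simpl in Hz.
  apply (RInt_correct f), (ex_RInt_interior f lo hi); auto.
  pose proof (Rmin_l (y - lo) (hi - y)); pose proof (Rmin_r (y - lo) (hi - y)).
  apply Rabs_def2 in Hz; lra.
Qed.

Lemma Rabs_lt_pos (x x' : R) : 0 < x -> Rabs (x' - x) < x / 2 -> 0 < x'.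
Proof. intros Hx H; apply Rabs_def2 in H; lra. Qed.

Section ParametricIntegral.

Variables (k : R -> R -> R) (lo hi c : R).
Hypothesis Hc : lo < c < hi.
Hypothesis Hk : forall x y, 0 < x -> lo < y < hi -> continuity_2d_pt k x y.

Lemma is_derive_RInt_upper (x y : R) : 0 < x -> lo < y < hi ->
  is_derive (fun z => RInt (k x) c z) y (k x y).
Proof.
  intros Hx Hy; apply (is_derive_RInt_interior (k x) lo hi); auto.
  intros z Hz; apply continuity_2d_pt_section; auto.
Qed.

Lemma continuous_RInt_param (x y : R) : 0 < x -> lo < y < hi ->
  continuous (fun u => RInt (k u) c y) x.
Proof.
  intros Hx Hy; apply filterlim_locally; intros eps.
  set (m := Rmin c y); set (M := Rmax c y).
  assert (Hm : lo < m <= M /\ M < hi).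
  { unfold m, M, Rmin, Rmax; destruct (Rle_dec c y); lra. }
  (* The summand 1 keeps the denominator positive when [c = y]. *)
  assert (He : 0 < eps / (2 * (M - m + 1))).
  { apply Rdiv_lt_0_compat; [apply cond_pos | lra]. }
  destruct (uniform_continuity_2d_1d' k m M x) with (eps := mkposreal _ He)
    as [d Hd].
  { intros z Hz; apply Hk; lra. }
  assert (Hd' : 0 < Rmin d (x / 2)) by (apply Rmin_pos; [apply cond_pos | lra]).
  exists (mkposreal _ Hd'); intros u Hu.
  change (Rabs (u - x) < Rmin d (x / 2)) in Hu.
  pose proof (Rmin_l d (x / 2)); pose proof (Rmin_r d (x / 2)).
  assert (Hu0 : 0 < u) by (apply (Rabs_lt_pos x); lra).
  assert (Hex : forall u, 0 < u -> ex_RInt (k u) c y).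
  { intros u' Hu'; apply (ex_RInt_interior _ lo hi); auto.
    intros z Hz; apply continuity_2d_pt_section; auto. }
  change (Rabs (RInt (k u) c y - RInt (k x) c y) < eps).
  assert (E : RInt (k u) c y - RInt (k x) c y = RInt (fun t => k u t - k x t) c y).
  { symmetry; apply (RInt_minus (V := R_CompleteNormedModule)); auto. }
  rewrite E.
  apply Rle_lt_trans with (Rabs (y - c) * (eps / (2 * (M - m + 1)))).
  - apply (norm_RInt_le_const_abs (V := R_NormedModule) (fun t => k u t - k x t) c y).
    + intros t Ht; unfold norm; simpl; unfold abs; simpl.
      fold m M in Ht; pose proof (cond_pos d); apply Rabs_def2 in Hu.
      left; apply Hd; try lra.
      rewrite Rminus_eq_0, Rabs_R0; lra.
    + apply (RInt_correct (V := R_CompleteNormedModule)).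
      apply (ex_RInt_minus (V := R_NormedModule)); auto.
  - assert (Rabs (y - c) = M - m).
    { unfold M, m, Rmin, Rmax; destruct (Rle_dec c y);
        [rewrite Rabs_pos_eq | rewrite Rabs_left]; lra. }
    rewrite H1.
    pose proof (cond_pos eps).
    replace ((M - m) * (eps / (2 * (M - m + 1)))) with (eps * ((M - m) / (2 * (M - m + 1)))) by (field; lra).
    rewrite <- (Rmult_1_r eps) at 2.
    apply Rmult_lt_compat_l; [lra | ].
    apply (Rdiv_lt_1 (M - m)); lra.
Qed.

(** Continuity in the parameter at the fixed endpoint [y] is combined with a Lipschitz bound in the
    endpoint, whose constant [M] is uniform over nearby parameters. *)
Lemma continuity_2d_pt_RInt (x y : R) : 0 < x -> lo < y < hi ->
  continuity_2d_pt (fun u v => RInt (k u) c v) x y.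
Proof.
  intros Hx Hy eps.
  assert (H1 := continuous_RInt_param x y Hx Hy).
  apply filterlim_locally with (eps := pos_div_2 eps) in H1; destruct H1 as [d1 H1].
  destruct (Hk x y Hx Hy (mkposreal 1 Rlt_0_1)) as [d2 H2]; simpl in H2.
  set (M := Rabs (k x y) + 1).
  assert (HM : 0 < M) by (unfold M; pose proof (Rabs_pos (k x y)); lra).
  assert (Hd : 0 < Rmin (Rmin d1 (x / 2)) (Rmin (Rmin d2 (eps / 2 / M)) (Rmin (y - lo) (hi - y)))).
  { repeat apply Rmin_pos; try apply cond_pos; try lra.
    repeat apply Rdiv_lt_0_compat; try apply cond_pos; lra. }
  exists (mkposreal _ Hd); simpl; intros u v Hu Hv.
  apply Rmin_Rgt_l in Hu; destruct Hu as [Hu Hu'].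
  apply Rmin_Rgt_l in Hv; destruct Hv as [_ Hv].
  apply Rmin_Rgt_l in Hu; destruct Hu as [Hu1 Hu2].
  apply Rmin_Rgt_l in Hv; destruct Hv as [Hv1 Hv2].
  apply Rmin_Rgt_l in Hv1; destruct Hv1 as [Hv1 Hv3].
  apply Rmin_Rgt_l in Hv2; destruct Hv2 as [Hv2 Hv4].
  apply Rmin_Rgt_l in Hu'; destruct Hu' as [Hu' _].
  apply Rmin_Rgt_l in Hu'; destruct Hu' as [Hu' _].
  apply Rgt_lt in Hu1, Hu2, Hv1, Hv3, Hv2, Hv4, Hu'.
  assert (Hu0 : 0 < u) by (apply (Rabs_lt_pos x); lra).
  assert (Hv0 : lo < v < hi) by (apply Rabs_def2 in Hv2; apply Rabs_def2 in Hv4; lra).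
  specialize (H1 u Hu1); change (Rabs (RInt (k u) c y - RInt (k x) c y) < eps / 2) in H1.
  assert (H3 : Rabs (RInt (k u) c v - RInt (k u) c y) < eps / 2).
  { destruct (MVT_gen (fun z => RInt (k u) c z) y v (k u)) as [z [Hz E]].
    - intros z Hz; apply is_derive_RInt_upper; auto.
      unfold Rmin, Rmax in Hz; destruct (Rle_dec y v); lra.
    - intros z Hz; apply continuity_pt_filterlim.
      apply (ex_derive_continuous (fun z => RInt (k u) c z)); eexists.
      apply is_derive_RInt_upper; auto.
      unfold Rmin, Rmax in Hz; destruct (Rle_dec y v); lra.
    - rewrite E, Rabs_mult.
      apply Rle_lt_trans with (M * Rabs (v - y)).
      + apply Rmult_le_compat_r; [apply Rabs_pos | ].
        assert (Rabs (k u z - k x y) < 1).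
        { apply H2; auto.
          eapply Rle_lt_trans; [ | exact Hv1].
          unfold Rmin, Rmax in Hz; destruct (Rle_dec y v);
            [rewrite !Rabs_pos_eq by lra | rewrite !Rabs_left1 by lra]; lra. }
        unfold M. pose proof (Rabs_triang_inv (k u z) (k x y)); lra.
      + apply Rlt_div_r in Hv3; [lra | exact HM]. }
  replace (RInt (k u) c v - RInt (k x) c y)
    with ((RInt (k u) c v - RInt (k u) c y) + (RInt (k u) c y - RInt (k x) c y)) by ring.
  eapply Rle_lt_trans; [apply Rabs_triang | lra].
Qed.

Lemma is_derive_RInt_param_continuous (K : R -> R -> R) (x y : R) :
  (forall x y, 0 < x -> lo < y < hi -> is_derive (fun u => K u y) x (k x y)) ->
  (forall x y, 0 < x -> lo < y < hi -> continuous (K x) y) ->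
  0 < x -> lo < y < hi ->
  is_derive (fun u => RInt (K u) c y) x (RInt (k x) c y).
Proof.
  intros HK HKc Hx Hy.
  assert (Hb : forall t, Rmin c y <= t <= Rmax c y -> lo < t < hi).
  { intros t; unfold Rmin, Rmax; destruct (Rle_dec c y); lra. }
  assert (Hloc : locally x (fun u => 0 < u)).
  { exists (mkposreal _ (is_pos_div_2 (mkposreal x Hx))); simpl; intros u Hu.
    apply (Rabs_lt_pos x); auto. }
  replace (RInt (k x) c y) with (RInt (fun t => Derive (fun u => K u t) x) c y).
  - apply (is_derive_RInt_param K c y x).
    + revert Hloc; apply filter_imp; intros u Hu t Ht; eexists; apply HK; auto.
    + intros t Ht; apply continuity_2d_pt_ext_loc with k; [ | apply Hk; auto].
      assert (Hd : 0 < Rmin (x / 2) (Rmin (t - lo) (hi - t))).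
      { specialize (Hb t Ht); repeat apply Rmin_pos; lra. }
      exists (mkposreal _ Hd); simpl; intros u v Hu Hv.
      apply Rmin_Rgt_l in Hu; destruct Hu as [Hu _].
      apply Rmin_Rgt_l in Hv; destruct Hv as [_ Hv].
      apply Rmin_Rgt_l in Hv; destruct Hv as [Hv1 Hv2].
      apply Rgt_lt in Hu, Hv1, Hv2.
      symmetry; apply is_derive_unique, HK.
      * apply (Rabs_lt_pos x); auto.
      * apply Rabs_def2 in Hv1; apply Rabs_def2 in Hv2; lra.
    + revert Hloc; apply filter_imp; intros u Hu.
      apply (ex_RInt_interior _ lo hi); auto.
  - apply RInt_ext; intros t Ht; apply is_derive_unique, HK; auto; apply Hb; lra.
Qed.

End ParametricIntegral.

(** * Differentiation along a level set *)

Lemma is_derive_nonneg_le (f df : R -> R) (y1 y2 : R) : y1 <= y2 ->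
  (forall z, y1 <= z <= y2 -> is_derive f z (df z) /\ 0 <= df z) -> f y1 <= f y2.
Proof.
  intros H Hf.
  destruct (MVT_gen f y1 y2 df) as [z [Hz E]];
    rewrite ?Rmin_left, ?Rmax_right in * by exact H.
  - intros z Hz; apply Hf; lra.
  - intros z Hz; apply continuity_pt_filterlim.
    apply (ex_derive_continuous f); eexists; apply Hf; lra.
  - assert (0 <= df z * (y2 - y1)) by (apply Rmult_le_pos; [apply Hf; lra | lra]); lra.
Qed.

(** A Cauchy mean value estimate that tolerates zeros of [p]: instead of dividing, it uses that
    [(R0 + e) * P - G] and [G - (R0 - e) * P] are both nondecreasing. *)
Lemma increment_ratio (G P q p : R -> R) (R0 e y1 y2 : R) : y1 <= y2 ->
  (forall z, y1 <= z <= y2 ->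
     is_derive G z (q z * p z) /\ is_derive P z (p z) /\ 0 <= p z /\
     Rabs (q z - R0) <= e) ->
  Rabs (G y2 - G y1 - R0 * (P y2 - P y1)) <= e * (P y2 - P y1).
Proof.
  intros H Hz.
  assert (Hu : (R0 + e) * P y1 - G y1 <= (R0 + e) * P y2 - G y2).
  { apply (is_derive_nonneg_le (fun z => (R0 + e) * P z - G z)
      (fun z => (R0 + e) * p z - q z * p z)); auto.
    intros z Hz'; destruct (Hz z Hz') as (HG & HP & Hp & HR); split.
    - apply (is_derive_minus (fun z => (R0 + e) * P z) G); auto.
      apply (is_derive_scal P); auto.
    - apply Rabs_le_between in HR; nra. }
  assert (Hl : G y1 - (R0 - e) * P y1 <= G y2 - (R0 - e) * P y2).
  { apply (is_derive_nonneg_le (fun z => G z - (R0 - e) * P z)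
      (fun z => q z * p z - (R0 - e) * p z)); auto.
    intros z Hz'; destruct (Hz z Hz') as (HG & HP & Hp & HR); split.
    - apply (is_derive_minus G (fun z => (R0 - e) * P z)); auto.
      apply (is_derive_scal P); auto.
    - apply Rabs_le_between in HR; nra. }
  apply Rabs_le; nra.
Qed.

(** Differentiability of [Q] makes [Q s - Q x] of order [s - x], so an error negligible against the
    former is negligible against the latter. With [Q] the identity this is the usual criterion for
    derivative 0; the level set argument takes for [Q] the value of [P] at a frozen angle. *)
Lemma is_derive_0_of_dominated (E Q : R -> R) (x q : R) :
  is_derive Q x q -> E x = 0 ->
  (forall e, 0 < e -> locally x (fun s => Rabs (E s) <= e * Rabs (Q s - Q x))) ->
  is_derive E x 0.
Proof.
  intros HQ HE H; apply is_derive_Reals; intros eps Heps.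
  apply is_derive_Reals in HQ; destruct (HQ 1 Rlt_0_1) as [d1 H1].
  assert (Hq : 0 < Rabs q + 1) by (pose proof (Rabs_pos q); lra).
  assert (He : 0 < eps / 2 / (Rabs q + 1)) by (repeat apply Rdiv_lt_0_compat; lra).
  destruct (H _ He) as [d2 H2].
  exists (mkposreal _ (Rmin_stable_in_posreal d1 d2)); simpl; intros h Hh Hd.
  apply Rmin_Rgt_l in Hd; destruct Hd as [Hd1 Hd2]; apply Rgt_lt in Hd1, Hd2.
  specialize (H1 h Hh Hd1).
  assert (Hb : ball x d2 (x + h)).
  { change (Rabs (x + h - x) < d2). now replace (x + h - x) with h by ring. }
  specialize (H2 _ Hb).
  rewrite HE, !Rminus_0_r, Rabs_div by exact Hh.
  assert (H3 : Rabs (Q (x + h) - Q x) <= (Rabs q + 1) * Rabs h).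
  { replace (Q (x + h) - Q x) with ((Q (x + h) - Q x) / h * h) by (field; exact Hh).
    rewrite Rabs_mult; apply Rmult_le_compat_r; [apply Rabs_pos | ].
    pose proof (Rabs_triang_inv ((Q (x + h) - Q x) / h) q); lra. }
  assert (Hah : 0 < Rabs h) by (apply Rabs_pos_lt; exact Hh).
  apply Rle_lt_trans with (eps / 2); [ | lra].
  apply Rle_div_l; [exact Hah | ].
  eapply Rle_trans; [exact H2 | ].
  replace (eps / 2 * Rabs h)
    with (eps / 2 / (Rabs q + 1) * ((Rabs q + 1) * Rabs h)) by (field; lra).
  apply Rmult_le_compat_l; lra.
Qed.

(* No implicit function theorem is available where [p] vanishes; the chain rule
   survives because increments of [G] in [y] are [R0 + o(1)] times those of [P]. *)
Lemma is_derive_along_level_set (G P q p : R -> R -> R) (alpha W : R -> R)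
    (tau rho GA PA dA lo hi : R) :
  (forall x y, 0 < x -> lo < y < hi ->
     is_derive (G x) y (q x y * p x y) /\ is_derive (P x) y (p x y) /\ 0 <= p x y) ->
  0 < alpha tau ->
  continuity_2d_pt q (alpha tau) (W tau) ->
  is_derive (fun x => G x (W tau)) (alpha tau) GA ->
  is_derive (fun x => P x (W tau)) (alpha tau) PA ->
  is_derive alpha tau dA ->
  continuous W tau ->
  locally tau (fun s => lo < W s < hi /\ P (alpha s) (W s) = rho) ->
  is_derive (fun s => G (alpha s) (W s)) tau
    (dA * (GA - q (alpha tau) (W tau) * PA)).
Proof.
  intros HGP Ha HR HG HP Hal HW Hloc.
  set (R0 := q (alpha tau) (W tau)) in *; set (w0 := W tau) in *.
  assert (Hw0 : lo < w0 < hi /\ P (alpha tau) w0 = rho).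
  { exact (locally_singleton _ _ Hloc). }
  assert (HPs : is_derive (fun s => P (alpha s) w0) tau (dA * PA)).
  { apply (is_derive_comp (fun x => P x w0) alpha); auto. }
  assert (HGs : is_derive (fun s => G (alpha s) w0) tau (dA * GA)).
  { apply (is_derive_comp (fun x => G x w0) alpha); auto. }
  set (E := fun s => G (alpha s) (W s) - G (alpha s) w0 + R0 * (P (alpha s) w0 - rho)).
  assert (HE : is_derive E tau 0).
  { apply (is_derive_0_of_dominated E (fun s => P (alpha s) w0) tau _ HPs).
    - unfold E; fold w0; destruct Hw0 as [_ ->]; ring.
    - intros e He.
      destruct (HR (mkposreal e He)) as [d Hd]; simpl in Hd.
      assert (Hal' : continuous alpha tau) by (apply (ex_derive_continuous alpha); eexists; eauto).
      assert (L1 := proj1 (filterlim_locally _ _) Hal' d).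
      assert (L2 := proj1 (filterlim_locally _ _) Hal' (pos_div_2 (mkposreal _ Ha))).
      assert (L3 := proj1 (filterlim_locally _ _) HW d).
      generalize (filter_and _ _ Hloc (filter_and _ _ L1 (filter_and _ _ L2 L3))).
      apply filter_imp; intros s [[HWs HPr] [B1 [B2 B3]]].
      change (Rabs (alpha s - alpha tau) < d) in B1.
      change (Rabs (alpha s - alpha tau) < alpha tau / 2) in B2.
      change (Rabs (W s - w0) < d) in B3.
      apply Rabs_lt_pos in B2; [ | exact Ha].
      destruct Hw0 as [Hw0 Hr0]; rewrite Hr0.
      assert (Hbnd : forall y1 y2 z, lo < y1 < hi -> lo < y2 < hi ->
        Rabs (y1 - w0) < d -> Rabs (y2 - w0) < d -> y1 <= z <= y2 ->
        is_derive (G (alpha s)) z (q (alpha s) z * p (alpha s) z) /\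
        is_derive (P (alpha s)) z (p (alpha s) z) /\ 0 <= p (alpha s) z /\
        Rabs (q (alpha s) z - R0) <= e).
      { intros y1 y2 z Hy1 Hy2 D1 D2 Hz.
        destruct (HGP (alpha s) z) as (X1 & X2 & X3); try lra.
        split; [exact X1 | split; [exact X2 | split; [exact X3 | ]]].
        left; apply Hd; auto.
        apply Rabs_def2 in D1; apply Rabs_def2 in D2; apply Rabs_def1; lra. }
      assert (D0 : Rabs (w0 - w0) < d) by (rewrite Rminus_eq_0, Rabs_R0; apply cond_pos).
      unfold E.
      destruct (Rle_lt_dec w0 (W s)) as [Hle | Hlt].
      + pose proof (increment_ratio (G (alpha s)) (P (alpha s)) (q (alpha s)) (p (alpha s))
          R0 e w0 (W s) Hle (fun z => Hbnd w0 (W s) z Hw0 HWs D0 B3)) as I.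
        rewrite HPr in I.
        replace (G (alpha s) (W s) - G (alpha s) w0 + R0 * (P (alpha s) w0 - rho))
          with (G (alpha s) (W s) - G (alpha s) w0 - R0 * (rho - P (alpha s) w0)) by ring.
        eapply Rle_trans; [exact I | ]; apply Rmult_le_compat_l; [lra | ].
        rewrite Rabs_minus_sym; apply Rle_abs.
      + pose proof (increment_ratio (G (alpha s)) (P (alpha s)) (q (alpha s)) (p (alpha s))
          R0 e (W s) w0 (Rlt_le _ _ Hlt) (fun z => Hbnd (W s) w0 z HWs Hw0 B3 D0)) as I.
        rewrite HPr in I.
        replace (G (alpha s) (W s) - G (alpha s) w0 + R0 * (P (alpha s) w0 - rho))
          with (- (G (alpha s) w0 - G (alpha s) (W s) - R0 * (P (alpha s) w0 - rho))) by ring.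
        rewrite Rabs_Ropp.
        eapply Rle_trans; [exact I | ]; apply Rmult_le_compat_l; [lra | apply Rle_abs]. }
  apply (is_derive_ext (fun s => E s + (G (alpha s) w0 - R0 * (P (alpha s) w0 - rho)))).
  { intros s; unfold E; eqR; ring. }
  replace (dA * (GA - R0 * PA)) with (0 + (dA * GA - R0 * (dA * PA - 0))) by ring.
  apply (is_derive_plus E _ tau); [exact HE | ].
  apply (is_derive_minus (fun s => G (alpha s) w0) _ tau); [exact HGs | ].
  apply (is_derive_scal (fun s => P (alpha s) w0 - rho)).
  apply (is_derive_minus (fun s => P (alpha s) w0) (fun _ => rho) tau); [exact HPs | ].
  apply (is_derive_const rho tau).
Qed.

(** * Integrals of [g (x * cos t)] *)

Lemma is_derive_0_eq (f : R -> R) (x y : R) :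
  (forall t, Rmin x y <= t <= Rmax x y -> is_derive f t 0) -> f x = f y.
Proof.
  intros H; unfold Rmin, Rmax in H; destruct (Rle_dec x y) as [Hxy | Hxy].
  - destruct Hxy as [Hxy | ->]; [ | reflexivity].
    apply (eq_is_derive (V := R_NormedModule) f x y); auto.
  - symmetry; apply (eq_is_derive (V := R_NormedModule) f y x); auto; lra.
Qed.

Lemma continuous_RtoR_of_derive (f : R -> R) (x l : R) : is_derive f x l -> continuous f x.
Proof. intros H; apply (ex_derive_continuous f); eexists; exact H. Qed.

Lemma locally_pos (x : R) : 0 < x -> locally x (fun u => 0 < u).
Proof. intros Hx; apply (open_gt 0 x Hx). Qed.

Lemma continuous_local_bound (f : R -> R) (x : R) : continuous f x ->
  exists d, 0 < d /\ forall y, Rabs (y - x) < d -> Rabs (f y) <= Rabs (f x) + 1.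
Proof.
  intros H; destruct (proj1 (filterlim_locally _ _) H (mkposreal 1 Rlt_0_1)) as [d Hd].
  exists d; split; [apply cond_pos | ]; intros y Hy.
  specialize (Hd y Hy); change (Rabs (f y - f x) < 1) in Hd.
  pose proof (Rabs_triang_inv (f y) (f x)); lra.
Qed.

Lemma scaling_neighbourhood (x e : R) : 0 < x -> 0 < e ->
  exists d, 0 < d /\ forall u c, Rabs (u - x) < d -> 1 - d < c <= 1 ->
    0 < u < 2 * x /\ 0 < c /\ Rabs (u - x) < e /\ Rabs (u * c - x) < e.
Proof.
  intros Hx He.
  assert (Hd : 0 < Rmin (Rmin (/ 2) (x / 2)) (Rmin (e / 2) (e / (4 * x)))).
  { repeat apply Rmin_pos; try apply Rdiv_lt_0_compat; lra. }
  exists (Rmin (Rmin (/ 2) (x / 2)) (Rmin (e / 2) (e / (4 * x)))); split; [exact Hd | ].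
  set (d := Rmin _ _) in *.
  assert (d <= / 2 /\ d <= x / 2 /\ d <= e / 2 /\ d <= e / (4 * x)) as (D1 & D2 & D3 & D4).
  { unfold d; pose proof (Rmin_l (Rmin (/ 2) (x / 2)) (Rmin (e / 2) (e / (4 * x)))).
    pose proof (Rmin_r (Rmin (/ 2) (x / 2)) (Rmin (e / 2) (e / (4 * x)))).
    pose proof (Rmin_l (/ 2) (x / 2)); pose proof (Rmin_r (/ 2) (x / 2)).
    pose proof (Rmin_l (e / 2) (e / (4 * x))); pose proof (Rmin_r (e / 2) (e / (4 * x))); lra. }
  intros u c Hu Hc.
  assert (Hux : 0 < u < 2 * x) by (apply Rabs_def2 in Hu; lra).
  assert (Huc : 0 <= u * (1 - c) < e / 2).
  { split; [apply Rmult_le_pos; lra | ].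
    apply Rle_lt_trans with (2 * x * (1 - c)); [apply Rmult_le_compat_r; lra | ].
    replace (e / 2) with (2 * x * (e / (4 * x))) by (field; lra).
    apply Rmult_lt_compat_l; lra. }
  repeat split; try lra.
  apply Rabs_def2 in Hu; apply Rabs_def1; lra.
Qed.

(** The form [h x (cos t) * cos t / sin t ^ 2 dt] after [t = v ^ 2]. At [v = 0] the factor [2 * v]
    gives the value 0 whatever the quotient is. *)
Definition kernel (h : R -> R -> R) (x v : R) : R :=
  h x (cos (v ^ 2)) * cos (v ^ 2) / sin (v ^ 2) ^ 2 * (2 * v).

Lemma continuous_cos_sq (v : R) : continuous (fun v => cos (v ^ 2)) v.
Proof. apply (ex_derive_continuous (fun v => cos (v ^ 2))); auto_derive; auto. Qed.

(* [1 - cos w] cancels one factor of [sin w ^ 2 = (1 - cos w) (1 + cos w)], so that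
   only a bounded function of [w = v ^ 2] remains, times [dw = 2 v dv]. *)
Lemma kernel_continuous_at_0 (h : R -> R -> R) (x B d : R) : 0 < d ->
  (forall u c, Rabs (u - x) < d -> 1 - d < c <= 1 -> Rabs (h u c) <= B * (1 - c)) ->
  continuity_2d_pt (kernel h) x 0.
Proof.
  intros Hd Hh eps.
  assert (Hcos := continuous_cos_sq 0).
  apply filterlim_locally with (eps := mkposreal d Hd) in Hcos.
  destruct Hcos as [d1 H1].
  assert (HB : 0 < 2 * (Rabs B + 1)) by (pose proof (Rabs_pos B); lra).
  assert (Hdel : 0 < Rmin (Rmin d d1) (Rmin 1 (eps / (2 * (Rabs B + 1))))).
  { repeat apply Rmin_pos; try apply cond_pos; try lra.
    apply Rdiv_lt_0_compat; [apply cond_pos | lra]. }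
  exists (mkposreal _ Hdel); simpl; intros u v Hu Hv.
  apply Rmin_Rgt_l in Hu; destruct Hu as [Hu _].
  apply Rmin_Rgt_l in Hu; destruct Hu as [Hu _].
  apply Rmin_Rgt_l in Hv; destruct Hv as [Hv1 Hv2].
  apply Rmin_Rgt_l in Hv1; destruct Hv1 as [_ Hv1].
  apply Rmin_Rgt_l in Hv2; destruct Hv2 as [Hv2 Hv3].
  apply Rgt_lt in Hu, Hv1, Hv2, Hv3.
  specialize (H1 v Hv1); change (Rabs (cos (v ^ 2) - cos (0 ^ 2)) < d) in H1.
  rewrite Rminus_0_r in Hv2, Hv3.
  replace (0 ^ 2) with 0 in H1 by ring; rewrite cos_0 in H1.
  assert (E0 : kernel h x 0 = 0) by (unfold kernel; ring).
  rewrite E0, Rminus_0_r.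
  destruct (Req_dec v 0) as [-> | Hv0].
  { replace (kernel h u 0) with 0 by (unfold kernel; ring).
    rewrite Rabs_R0; apply cond_pos. }
  assert (Hv4 : 0 < v ^ 2 < 1).
  { split; [apply pow2_gt_0; auto | ].
    rewrite <- Rsqr_pow2; replace 1 with (Rsqr 1) by (unfold Rsqr; ring).
    apply Rsqr_lt_abs_1; rewrite (Rabs_pos_eq 1); lra. }
  pose proof PI2_1 as HPI.
  assert (Hc : 0 < cos (v ^ 2)) by (apply cos_gt_0; lra).
  assert (Hs : 0 < sin (v ^ 2)) by (apply sin_gt_0; lra).
  unfold kernel; set (c := cos (v ^ 2)) in *; set (s := sin (v ^ 2)) in *.
  assert (Hsc : s ^ 2 = (1 - c) * (1 + c)).
  { unfold s, c; pose proof (sin2_cos2 (v ^ 2)) as E; unfold Rsqr in E; nra. }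
  assert (Hc1 : 0 < 1 - c).
  { assert (0 < s ^ 2) by (apply pow_lt; auto). nra. }
  assert (Hhu : Rabs (h u c) <= B * (1 - c)).
  { apply Hh; auto; apply Rabs_def2 in H1; lra. }
  unfold Rdiv; rewrite !Rabs_mult, Rabs_inv, (Rabs_pos_eq c), (Rabs_pos_eq (s ^ 2)), (Rabs_pos_eq 2)
    by (try lra; apply pow2_ge_0).
  apply Rle_lt_trans with (B * (2 * Rabs v)).
  - apply Rmult_le_compat_r; [pose proof (Rabs_pos v); lra | ].
    rewrite Hsc; apply Rmult_le_reg_r with ((1 - c) * (1 + c)); [nra | ].
    replace (Rabs (h u c) * c * / ((1 - c) * (1 + c)) * ((1 - c) * (1 + c)))
      with (Rabs (h u c) * c) by (field; lra).
    assert (0 <= B * (1 - c)) by (pose proof (Rabs_pos (h u c)); lra).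
    apply Rle_trans with (B * (1 - c) * c); [apply Rmult_le_compat_r; lra | ].
    rewrite <- Rmult_assoc; apply Rmult_le_compat_l; lra.
  - apply Rle_lt_trans with (Rabs v * (2 * (Rabs B + 1))).
    + pose proof (Rle_abs B); pose proof (Rabs_pos v); nra.
    + apply Rlt_div_r; [exact HB | exact Hv3].
Qed.

Lemma sqrt_PI_bounds (v : R) : - sqrt PI < v < sqrt PI -> v <> 0 -> 0 < v ^ 2 < PI.
Proof.
  intros Hv H0; split; [apply pow2_gt_0; auto | ].
  pose proof PI_RGT_0; rewrite <- (sqrt_sqrt PI) by lra; nra.
Qed.

Lemma kernel_continuous (h : R -> R -> R) (x v : R) :
  - sqrt PI < v < sqrt PI -> v <> 0 ->
  continuity_2d_pt h x (cos (v ^ 2)) -> continuity_2d_pt (kernel h) x v.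
Proof.
  intros Hv H0 Hh; unfold kernel.
  assert (Hs : 0 < sin (v ^ 2)).
  { pose proof (sqrt_PI_bounds v Hv H0); apply sin_gt_0; lra. }
  assert (Hcos : continuity_2d_pt (fun _ v : R => cos (v ^ 2)) x v).
  { apply (continuity_2d_pt_comp1 (fun v => cos (v ^ 2)) (fun _ v => v));
      [apply continuous_cos_sq | apply continuity_2d_pt_id2]. }
  apply continuity_2d_pt_mult; [apply continuity_2d_pt_mult | ].
  - apply continuity_2d_pt_mult; auto.
    apply (continuity_2d_pt_comp2 h (fun u _ => u) (fun _ v => cos (v ^ 2))); auto.
    apply continuity_2d_pt_id1.
  - apply (continuity_2d_pt_comp1 (fun v => / sin (v ^ 2) ^ 2) (fun _ v => v));
      [ | apply continuity_2d_pt_id2].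
    apply (ex_derive_continuous (fun v => / sin (v ^ 2) ^ 2)); auto_derive.
    simpl in Hs; nra.
  - apply (continuity_2d_pt_mult (fun _ _ => 2) (fun _ v => v));
      [apply continuity_2d_pt_const | apply continuity_2d_pt_id2].
Qed.

(* In the variable y = a(t): phi = a / a', psi = y phi'(y), kappa = a', extended evenly. *)
Record is_profile (phi psi kappa : R -> R) : Prop := {
  phi_even : forall y, phi (- y) = phi y;
  psi_even : forall y, psi (- y) = psi y;
  phi_continuous : forall y, continuous phi y;
  psi_continuous : forall y, continuous psi y;
  kappa_continuous : forall y, continuous kappa y;
  phi_0 : phi 0 = 0;
  psi_0 : psi 0 = 0;
  phi_pos : forall y, y <> 0 -> 0 < phi y;
  kappa_phi : forall y, kappa y * phi y = Rabs y;
  phi_derive : forall y, y <> 0 -> is_derive phi y (psi y / y);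
  psi_lipschitz : forall y, 0 < y -> exists L d, 0 <= L /\ 0 < d /\
    forall y1 y2, Rabs (y1 - y) < d -> Rabs (y2 - y) < d ->
      Rabs (psi y1 - psi y2) <= L * Rabs (y1 - y2)
}.

Definition cos_integral (g : R -> R) (x w : R) : R := RInt (fun t => g (x * cos t)) 0 w.

Lemma continuity_2d_pt_cos_comp (g : R -> R) (x w : R) :
  (forall y, continuous g y) -> continuity_2d_pt (fun x w => g (x * cos w)) x w.
Proof.
  intros Hg; apply (continuity_2d_pt_comp1 g); auto.
  apply continuity_2d_pt_mult; [apply continuity_2d_pt_id1 | ].
  apply (continuity_2d_pt_comp1 cos (fun _ w => w)); [apply continuous_cos | apply continuity_2d_pt_id2].
Qed.

Lemma cos_integral_derive (g : R -> R) (x w : R) :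
  (forall y, continuous g y) -> is_derive (cos_integral g x) w (g (x * cos w)).
Proof.
  intros Hg.
  apply (is_derive_RInt_interior (fun t => g (x * cos t)) (- Rabs w - 1) (Rabs w + 1)).
  - pose proof (Rabs_pos w); lra.
  - pose proof (Rabs_maj2 w); pose proof (Rle_abs w); lra.
  - intros z _; apply (continuity_2d_pt_section (fun x t => g (x * cos t))).
    apply continuity_2d_pt_cos_comp, Hg.
Qed.

Lemma cos_integral_0 (g : R -> R) (x : R) : cos_integral g x 0 = 0.
Proof. apply (RInt_point (V := R_CompleteNormedModule)). Qed.

Lemma cos_integral_continuous (g : R -> R) (x w : R) :
  (forall y, continuous g y) -> 0 < x -> continuity_2d_pt (cos_integral g) x w.
Proof.
  intros Hg Hx.
  apply (continuity_2d_pt_RInt (fun x t => g (x * cos t)) (- Rabs w - 1) (Rabs w + 1)); auto.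
  - pose proof (Rabs_pos w); lra.
  - intros x' y' _ _; apply continuity_2d_pt_cos_comp, Hg.
  - pose proof (Rabs_maj2 w); pose proof (Rle_abs w); lra.
Qed.

(** For even [g] the integrand [g (x * cos t)] is symmetric about [t = PI / 2]. *)
Lemma cos_integral_reflect (g : R -> R) (x w : R) :
  (forall y, continuous g y) -> (forall y, g (- y) = g y) ->
  cos_integral g x (PI - w) = 2 * cos_integral g x (PI / 2) - cos_integral g x w.
Proof.
  intros Hg He.
  assert (E : cos_integral g x (PI - w) + cos_integral g x w =
              cos_integral g x (PI - PI / 2) + cos_integral g x (PI / 2)).
  { apply (is_derive_0_eq (fun w => cos_integral g x (PI - w) + cos_integral g x w)).
    intros t _.
    replace 0 with (-1 * g (x * cos (PI - t)) + g (x * cos t)).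
    - apply (is_derive_plus (fun w => cos_integral g x (PI - w)) (cos_integral g x) t);
        [ | apply cos_integral_derive; auto].
      apply (is_derive_comp (cos_integral g x) (fun w => PI - w)).
      + apply cos_integral_derive; auto.
      + auto_derive; auto; ring.
    - replace (cos (PI - t)) with (- cos t).
      + rewrite Ropp_mult_distr_r_reverse, He; ring.
      + rewrite cos_minus, cos_PI, sin_PI; ring. }
  replace (PI - PI / 2) with (PI / 2) in E by field; lra.
Qed.

(** * Differentiating the integral of [g (x * cos t)] in [x] for a locally Lipschitz [g] *)

Section AbelTransform.

Variable g : R -> R.
Hypothesis g_cont : forall y, continuous g y.
Hypothesis g_lip : forall y, 0 < y -> exists L d, 0 <= L /\ 0 < d /\
  forall y1 y2, Rabs (y1 - y) < d -> Rabs (y2 - y) < d ->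
    Rabs (g y1 - g y2) <= L * Rabs (y1 - y2).

Let G (y : R) : R := RInt g 0 y.
(** The t-derivative of [h0 x (cos t)] is [x * sin t * g (x * cos t)], and the constant of
    integration is chosen so that [h0] vanishes at [c = 1]. [h1] is the x-derivative of [h0]. *)
Let h0 (x c : R) : R := G x - G (x * c).
Let h1 (x c : R) : R := g x - c * g (x * c).

Lemma primitive_derive (y : R) : is_derive G y (g y).
Proof.
  apply (is_derive_RInt_interior g (- Rabs y - 1) (Rabs y + 1)).
  - pose proof (Rabs_pos y); lra.
  - pose proof (Rabs_maj2 y); pose proof (Rle_abs y); lra.
  - intros z _; apply g_cont.
Qed.

Lemma primitive_continuous (y : R) : continuous G y.
Proof. eapply continuous_RtoR_of_derive, primitive_derive. Qed.

Lemma h0_bound (x : R) : 0 < x -> exists B d, 0 < d /\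
  forall u c, Rabs (u - x) < d -> 1 - d < c <= 1 -> Rabs (h0 u c) <= B * (1 - c).
Proof.
  intros Hx.
  destruct (continuous_local_bound g x (g_cont x)) as [e [He Hg]].
  destruct (scaling_neighbourhood x e Hx He) as [d [Hd H]].
  exists ((Rabs (g x) + 1) * (2 * x)), d; split; [exact Hd | ]; intros u c Hu Hc.
  destruct (H u c Hu Hc) as (H1 & H2 & H3 & H4).
  destruct (MVT_gen G (u * c) u g) as [z [Hz E]].
  - intros; apply primitive_derive.
  - intros; apply continuity_pt_filterlim, primitive_continuous.
  - unfold h0; rewrite E, Rabs_mult.
    assert (u * c <= u) by nra.
    rewrite Rmin_left, Rmax_right in Hz by lra.
    apply Rle_trans with ((Rabs (g x) + 1) * Rabs (u - u * c)).
    + apply Rmult_le_compat_r; [apply Rabs_pos | apply Hg].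
      apply Rabs_def2 in H3; apply Rabs_def2 in H4; apply Rabs_def1; lra.
    + rewrite Rmult_assoc; apply Rmult_le_compat_l; [pose proof (Rabs_pos (g x)); lra | ].
      rewrite Rabs_pos_eq by lra; nra.
Qed.

(** The Lipschitz hypothesis enters here, through the splitting [g u - c * g (u * c) = g u * (1 - c)
    + c * (g u - g (u * c))]. The factor [2 * x] in the constant bounds the [u] of the increment
    [u * (1 - c)]. *)
Lemma h1_bound (x : R) : 0 < x -> exists B d, 0 < d /\
  forall u c, Rabs (u - x) < d -> 1 - d < c <= 1 -> Rabs (h1 u c) <= B * (1 - c).
Proof.
  intros Hx.
  destruct (continuous_local_bound g x (g_cont x)) as [e [He Hg]].
  destruct (g_lip x Hx) as (L & e' & HL & He' & Hlip).
  destruct (scaling_neighbourhood x (Rmin e e') Hx) as [d [Hd H]];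
    [apply Rmin_pos; auto | ].
  exists ((Rabs (g x) + 1) + L * (2 * x)), d; split; [exact Hd | ]; intros u c Hu Hc.
  destruct (H u c Hu Hc) as (H1 & H2 & H3 & H4).
  apply Rmin_Rgt_l in H3; apply Rmin_Rgt_l in H4.
  destruct H3 as [H3 H3'], H4 as [H4 H4'].
  specialize (Hg u H3); specialize (Hlip u (u * c) H3' H4').
  unfold h1; replace (g u - c * g (u * c)) with (g u * (1 - c) + c * (g u - g (u * c))) by ring.
  eapply Rle_trans; [apply Rabs_triang | ].
  rewrite !Rabs_mult, (Rabs_pos_eq (1 - c)), (Rabs_pos_eq c) by lra.
  rewrite Rmult_plus_distr_r; apply Rplus_le_compat.
  - apply Rmult_le_compat_r; lra.
  - replace (u - u * c) with (u * (1 - c)) in Hlip by ring.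
    rewrite Rabs_mult, (Rabs_pos_eq u), (Rabs_pos_eq (1 - c)) in Hlip by lra.
    assert (0 <= Rabs (g u - g (u * c))) by apply Rabs_pos.
    apply Rle_trans with (1 * (L * (u * (1 - c)))).
    + apply Rmult_le_compat; lra.
    + rewrite Rmult_1_l, Rmult_assoc; apply Rmult_le_compat_l; [exact HL | ].
      apply Rmult_le_compat_r; lra.
Qed.

Lemma h0_continuous (x c : R) : continuity_2d_pt h0 x c.
Proof.
  apply continuity_2d_pt_minus.
  - apply (continuity_2d_pt_comp1 G (fun x _ => x)); [apply primitive_continuous | apply continuity_2d_pt_id1].
  - apply (continuity_2d_pt_comp1 G); [apply primitive_continuous | ].
    apply continuity_2d_pt_mult; [apply continuity_2d_pt_id1 | apply continuity_2d_pt_id2].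
Qed.

Lemma h1_continuous (x c : R) : continuity_2d_pt h1 x c.
Proof.
  apply continuity_2d_pt_minus.
  - apply (continuity_2d_pt_comp1 g (fun x _ => x)); [apply g_cont | apply continuity_2d_pt_id1].
  - apply continuity_2d_pt_mult; [apply continuity_2d_pt_id2 | ].
    apply (continuity_2d_pt_comp1 g); [apply g_cont | ].
    apply continuity_2d_pt_mult; [apply continuity_2d_pt_id1 | apply continuity_2d_pt_id2].
Qed.

Lemma kernel_continuous_all (h : R -> R -> R) :
  (forall x c, continuity_2d_pt h x c) ->
  (forall x, 0 < x -> exists B d, 0 < d /\
     forall u c, Rabs (u - x) < d -> 1 - d < c <= 1 -> Rabs (h u c) <= B * (1 - c)) ->
  forall x v, 0 < x -> - sqrt PI < v < sqrt PI -> continuity_2d_pt (kernel h) x v.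
Proof.
  intros Hh Hb x v Hx Hv; destruct (Req_dec v 0) as [-> | H0].
  - destruct (Hb x Hx) as (B & d & Hd & H).
    apply (kernel_continuous_at_0 h x B d); auto.
  - apply kernel_continuous; auto.
Qed.

Let sqrt_PI_pos : - sqrt PI < 0 < sqrt PI.
Proof. pose proof (sqrt_lt_R0 PI PI_RGT_0); lra. Qed.

Lemma sqrt_bounds (w : R) : 0 < w < PI -> - sqrt PI < sqrt w < sqrt PI /\ 0 < sqrt w.
Proof.
  intros Hw; pose proof (sqrt_lt_R0 w (proj1 Hw)); pose proof (sqrt_lt_1 w PI); lra.
Qed.

Definition abel_kernel_integral (h : R -> R -> R) (x v : R) : R := RInt (kernel h x) 0 v.

Let T0 := abel_kernel_integral h0.
Let T1 := abel_kernel_integral h1.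

Lemma T0_derive (x v : R) : 0 < x -> - sqrt PI < v < sqrt PI ->
  is_derive (fun x => T0 x v) x (T1 x v).
Proof.
  intros Hx Hv.
  apply (is_derive_RInt_param_continuous (kernel h1) (- sqrt PI) (sqrt PI) 0); auto.
  - apply kernel_continuous_all; [apply h1_continuous | apply h1_bound].
  - clear x v Hx Hv; intros x v Hx Hv; unfold kernel, h0, h1.
    set (c := cos (v ^ 2)).
    apply (is_derive_ext (fun u => (c / sin (v ^ 2) ^ 2 * (2 * v)) * (G u - G (u * c)))).
    { intros u; eqR; unfold Rdiv; ring. }
    replace ((g x - c * g (x * c)) * c / sin (v ^ 2) ^ 2 * (2 * v))
      with ((c / sin (v ^ 2) ^ 2 * (2 * v)) * (g x - c * g (x * c))) by (unfold Rdiv; ring).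
    apply (is_derive_scal (fun u => G u - G (u * c))).
    apply (is_derive_minus G (fun u => G (u * c))); [apply primitive_derive | ].
    apply (is_derive_comp G (fun u => u * c)); [apply primitive_derive | ].
    auto_derive; auto; ring.
  - intros x' v' Hx' Hv'; apply continuity_2d_pt_section.
    apply kernel_continuous_all; auto; [apply h0_continuous | apply h0_bound].
Qed.

Lemma T1_continuous (x v : R) : 0 < x -> - sqrt PI < v < sqrt PI -> continuity_2d_pt T1 x v.
Proof.
  intros Hx Hv; apply (continuity_2d_pt_RInt (kernel h1) (- sqrt PI) (sqrt PI) 0); auto.
  apply kernel_continuous_all; [apply h1_continuous | apply h1_bound].
Qed.

Lemma T0_derive_upper (x v : R) : 0 < x -> - sqrt PI < v < sqrt PI ->
  is_derive (T0 x) v (kernel h0 x v).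
Proof.
  exact (is_derive_RInt_upper (kernel h0) (- sqrt PI) (sqrt PI) 0 sqrt_PI_pos
    (kernel_continuous_all h0 h0_continuous h0_bound) x v).
Qed.

(** The result of integrating [x * g (x * cos t)] by parts, as the product of [/ sin t] with the
    t-derivative of [h0 x (cos t)]: a boundary term at [w] plus the kernel integral, in the variable
    [sqrt w]. *)
Let S (x w : R) : R := h0 x (cos w) / sin w + T0 x (sqrt w).

Lemma S_derive_angle (x w : R) : 0 < x -> 0 < w < PI ->
  is_derive (S x) w (x * g (x * cos w)).
Proof.
  intros Hx Hw.
  destruct (sqrt_bounds w Hw) as [Hs1 Hs2].
  assert (Hs : 0 < sin w) by (apply sin_gt_0; lra).
  (* The factor [/ (2 * sqrt w)] of the chain rule removes the [2 * v] of the kernel, leaving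
     [h0 * cos w / sin w ^ 2]; this cancels the second term of the quotient rule. *)
  assert (E : x * g (x * cos w) =
    (x * sin w * g (x * cos w) * sin w - h0 x (cos w) * cos w) / sin w ^ 2
    + / (2 * sqrt w) * kernel h0 x (sqrt w)).
  { unfold kernel; rewrite pow2_sqrt by lra; field; lra. }
  rewrite E.
  apply (is_derive_plus (fun w => h0 x (cos w) / sin w) (fun w => T0 x (sqrt w))).
  - apply (is_derive_div (fun w => h0 x (cos w)) sin); [ | apply is_derive_sin | lra].
    unfold h0.
    replace (x * sin w * g (x * cos w)) with (0 - (- (x * sin w)) * g (x * cos w)) by ring.
    apply (is_derive_minus (fun _ => G x) (fun w => G (x * cos w))); [apply (is_derive_const (G x) w) | ].
    apply (is_derive_comp G (fun w => x * cos w)); [apply primitive_derive | ].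
    auto_derive; auto; ring.
  - apply (is_derive_comp (T0 x) sqrt).
    + apply T0_derive_upper; auto.
    + auto_derive; [lra | field; lra].
Qed.

(** Both sides have the same derivative on [(0, PI)], so their difference is constant. The boundary
    term is 0/0 at [w = 0], hence the constant is shown to be 0 by evaluating the difference at
    arbitrarily small angles. *)
Lemma S_eq (x w : R) : 0 < x -> 0 < w < PI -> S x w = x * cos_integral g x w.
Proof.
  intros Hx Hw.
  apply Rminus_diag_uniq, cond_eq; intros e He; rewrite Rminus_0_r.
  destruct (h0_bound x Hx) as (B & d & Hd & HB).
  set (D := fun w => S x w - x * cos_integral g x w).
  assert (HD : forall w', 0 < w' < PI -> D w = D w').
  { intros w' Hw'; apply (is_derive_0_eq D); intros t Ht.
    assert (0 < t < PI) by (unfold Rmin, Rmax in Ht; destruct (Rle_dec w w'); lra).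
    replace 0 with (x * g (x * cos t) - x * g (x * cos t)) by ring.
    apply (is_derive_minus (S x) (fun w => x * cos_integral g x w)).
    - apply S_derive_angle; auto.
    - apply (is_derive_scal (cos_integral g x)), cos_integral_derive, g_cont. }
  (* A bound for the difference at small angles that is continuous and vanishes at 0. The boundary
     term is at most [B * sin w] because [1 - cos w <= sin w ^ 2] when [cos w >= 0]. *)
  set (M := fun w => B * sin w + Rabs (T0 x (sqrt w)) + x * Rabs (cos_integral g x w)).
  assert (HM : continuous M 0).
  { apply (continuous_plus (fun w => B * sin w + Rabs (T0 x (sqrt w)))).
    - apply (continuous_plus (fun w => B * sin w)).
      + apply (continuous_scal_r B sin), continuous_sin.
      + apply (continuous_comp (fun w => T0 x (sqrt w)) Rabs); [ | apply continuous_Rabs].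
        apply (continuous_comp sqrt (T0 x)).
        * apply continuous_sqrt.
        * rewrite sqrt_0; eapply continuous_RtoR_of_derive.
          apply T0_derive_upper; auto.
    - apply (continuous_scal_r x (fun w => Rabs (cos_integral g x w))).
      apply (continuous_comp (cos_integral g x) Rabs); [ | apply continuous_Rabs].
      eapply continuous_RtoR_of_derive, cos_integral_derive, g_cont. }
  assert (HM0 : M 0 = 0).
  { unfold M; rewrite sin_0, sqrt_0, cos_integral_0.
    replace (T0 x 0) with 0.
    - rewrite Rabs_R0; ring.
    - symmetry; apply (RInt_point (V := R_CompleteNormedModule)). }
  destruct (proj1 (filterlim_locally _ _) HM (mkposreal e He)) as [d1 H1].
  destruct (proj1 (filterlim_locally _ _) (continuous_cos 0) (mkposreal d Hd)) as [d2 H2].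
  assert (Hmin : 0 < Rmin (Rmin d1 d2) 1).
  { repeat apply Rmin_pos; try apply cond_pos; lra. }
  set (w' := Rmin (Rmin d1 d2) 1 / 2).
  assert (Hw' : 0 < w' < d1 /\ w' < d2 /\ w' < 1).
  { unfold w'; pose proof (Rmin_l (Rmin d1 d2) 1); pose proof (Rmin_r (Rmin d1 d2) 1).
    pose proof (Rmin_l d1 d2); pose proof (Rmin_r d1 d2); lra. }
  pose proof PI2_1 as HPI.
  assert (Hs : 0 < sin w') by (apply sin_gt_0; lra).
  assert (Hc : 0 < cos w') by (apply cos_gt_0; lra).
  assert (B1 : ball 0 d1 w') by (change (Rabs (w' - 0) < d1); rewrite Rabs_pos_eq; lra).
  assert (B2 : ball 0 d2 w') by (change (Rabs (w' - 0) < d2); rewrite Rabs_pos_eq; lra).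
  specialize (H1 w' B1); specialize (H2 w' B2).
  change (Rabs (M w' - M 0) < e) in H1; change (Rabs (cos w' - cos 0) < d) in H2.
  rewrite HM0, Rminus_0_r in H1; rewrite cos_0 in H2.
  fold (D w); rewrite (HD w') by lra.
  eapply Rle_lt_trans; [ | apply (Rle_lt_trans _ _ _ (Rle_abs _) H1)].
  unfold D, S, M.
  replace (h0 x (cos w') / sin w' + T0 x (sqrt w') - x * cos_integral g x w')
    with (h0 x (cos w') / sin w' + T0 x (sqrt w') + - (x * cos_integral g x w')) by ring.
  eapply Rle_trans; [apply Rabs_triang | ].
  rewrite Rabs_Ropp, Rabs_mult, (Rabs_pos_eq x) by lra.
  apply Rplus_le_compat_r.
  eapply Rle_trans; [apply Rabs_triang | ].
  apply Rplus_le_compat_r.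
  rewrite Rabs_div, (Rabs_pos_eq (sin w')) by lra.
  apply Rle_div_l; [exact Hs | ].
  pose proof (sin2_cos2 w') as E; unfold Rsqr in E.
  pose proof (COS_bound w').
  assert (HBc : Rabs (h0 x (cos w')) <= B * (1 - cos w')).
  { apply HB; [rewrite Rminus_eq_0, Rabs_R0; exact Hd | ].
    apply Rabs_def2 in H2; lra. }
  eapply Rle_trans; [exact HBc | ].
  assert (0 < sin w' * sin w') by (apply Rmult_lt_0_compat; auto).
  assert (0 < 1 - cos w') by nra.
  assert (0 <= B) by (pose proof (Rabs_pos (h0 x (cos w'))); nra).
  rewrite Rmult_assoc; apply Rmult_le_compat_l; nra.
Qed.

(** The x-derivative of [S x w / x], with [S] rewritten as [x] times the integral in the last term
    of the quotient rule. *)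
Definition cos_integral_dx (x w : R) : R :=
  (h1 x (cos w) / sin w + T1 x (sqrt w) - cos_integral g x w) / x.

(* [g] need not be continuously differentiable: integrating by parts leaves only
   increments of [g] under the integral sign. *)
Lemma cos_integral_derive_l (x w : R) : 0 < x -> 0 < w < PI ->
  is_derive (fun x => cos_integral g x w) x (cos_integral_dx x w).
Proof.
  intros Hx Hw.
  assert (Hs : 0 < sin w) by (apply sin_gt_0; lra).
  apply (is_derive_ext_loc (fun x => S x w / x)).
  { generalize (locally_pos x Hx); apply filter_imp; intros u Hu.
    eqR; rewrite S_eq by auto; field; lra. }
  replace (cos_integral_dx x w)
    with (((/ sin w * (g x - cos w * g (x * cos w)) + T1 x (sqrt w)) * x - S x w * 1) / x ^ 2).
  2:{ rewrite S_eq by auto; unfold cos_integral_dx, h1; field; lra. }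
  apply (is_derive_div (fun x => S x w) (fun x => x)); [ | apply (is_derive_id x) | lra].
  apply (is_derive_plus (fun x => h0 x (cos w) / sin w) (fun x => T0 x (sqrt w))).
  - apply (is_derive_ext (fun x => / sin w * (G x - G (x * cos w)))).
    { intros u; eqR; unfold h0, Rdiv; ring. }
    apply (is_derive_scal (fun x => G x - G (x * cos w))).
    apply (is_derive_minus G (fun x => G (x * cos w))); [apply primitive_derive | ].
    apply (is_derive_comp G (fun x => x * cos w)); [apply primitive_derive | ].
    auto_derive; auto; ring.
  - apply T0_derive; auto; apply sqrt_bounds; auto.
Qed.

Lemma cos_integral_dx_continuous (x w : R) : 0 < x -> 0 < w < PI ->
  continuity_2d_pt cos_integral_dx x w.
Proof.
  intros Hx Hw.
  assert (Hs : 0 < sin w) by (apply sin_gt_0; lra).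
  apply continuity_2d_pt_mult.
  - apply continuity_2d_pt_minus; [ | apply cos_integral_continuous; auto].
    apply continuity_2d_pt_plus.
    + apply continuity_2d_pt_mult.
      * apply (continuity_2d_pt_comp2 h1 (fun x _ => x) (fun _ w => cos w)).
        -- apply h1_continuous.
        -- apply continuity_2d_pt_id1.
        -- apply (continuity_2d_pt_comp1 cos (fun _ w => w)); [apply continuous_cos | apply continuity_2d_pt_id2].
      * apply (continuity_2d_pt_comp1 (fun w => / sin w) (fun _ w => w)); [ | apply continuity_2d_pt_id2].
        apply (ex_derive_continuous (fun w => / sin w)); auto_derive; lra.
    + apply (continuity_2d_pt_comp2 T1 (fun x _ => x) (fun _ w => sqrt w)).
      * apply T1_continuous; auto; apply sqrt_bounds; auto.
      * apply continuity_2d_pt_id1.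
      * apply (continuity_2d_pt_comp1 sqrt (fun _ w => w)); [apply continuous_sqrt | apply continuity_2d_pt_id2].
  - apply continuity_2d_pt_inv; [apply continuity_2d_pt_id1 | lra].
Qed.

End AbelTransform.

(** * The metric coefficient as a function of the angle *)

(* Encodes the rule f(tau, t0) = 2 f(tau, 0) - f(tau, - t0) for t0 < 0, i.e. w > pi/2. *)
Definition corr (w : R) : R := if Rle_dec w (PI / 2) then 0 else 1 - sin w.
Definition dcorr (w : R) : R := if Rle_dec w (PI / 2) then 0 else - cos w.

(** With [t = w - PI / 2 > 0] the value is [1 - cos t <= sin t ^ 2 <= t ^ 2]. This quadratic
    vanishing makes [corr] differentiable at the junction [PI / 2]. *)
Lemma corr_abs_bound (w : R) : Rabs (w - PI / 2) < PI / 2 ->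
  Rabs (corr w) <= Rabs (w - PI / 2) * Rabs (w - PI / 2).
Proof.
  intros Hw; unfold corr; destruct (Rle_dec w (PI / 2)) as [H | H].
  - rewrite Rabs_R0; apply Rmult_le_pos; apply Rabs_pos.
  - assert (E : sin w = cos (w - PI / 2)).
    { rewrite cos_minus, cos_PI2, sin_PI2; ring. }
    rewrite E; set (t := w - PI / 2) in *.
    assert (Ht : 0 < t) by (unfold t; lra).
    rewrite (Rabs_pos_eq t) in * by lra.
    pose proof (COS_bound t); rewrite Rabs_pos_eq by lra.
    assert (Hc : 0 <= cos t) by (apply cos_ge_0; lra).
    assert (Hst : sin t <= t) by (left; apply sin_lt_x; lra).
    assert (0 <= sin t) by (apply sin_ge_0; lra).
    pose proof (sin2_cos2 t) as E2; unfold Rsqr in E2; nra.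
Qed.

Lemma corr_derive (w : R) : is_derive corr w (dcorr w).
Proof.
  destruct (total_order_T w (PI / 2)) as [[H | H] | H].
  - apply (is_derive_ext_loc (fun _ : R => 0)).
    + generalize (open_lt (PI / 2) w H); apply filter_imp; intros u Hu.
      unfold corr; destruct (Rle_dec u (PI / 2)); [reflexivity | lra].
    + unfold dcorr; destruct (Rle_dec w (PI / 2)); [apply (is_derive_const 0 w) | lra].
  - assert (E : corr w = 0 /\ dcorr w = 0).
    { unfold corr, dcorr; destruct (Rle_dec w (PI / 2)); [auto | lra]. }
    destruct E as [E1 ->].
    apply (is_derive_0_of_dominated corr (fun u => u) w 1 (is_derive_id w) E1).
    intros e He.
    assert (Hm : 0 < Rmin e (PI / 2)) by (apply Rmin_pos; [exact He | pose proof PI_RGT_0; lra]).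
    exists (mkposreal _ Hm); intros u Hu; change (Rabs (u - w) < Rmin e (PI / 2)) in Hu.
    apply Rmin_Rgt_l in Hu; destruct Hu as [H1 H2]; rewrite H in *.
    eapply Rle_trans; [apply corr_abs_bound; exact H2 | ].
    apply Rmult_le_compat_r; [apply Rabs_pos | lra].
  - apply (is_derive_ext_loc (fun u => 1 - sin u)).
    + generalize (open_gt (PI / 2) w H); apply filter_imp; intros u Hu.
      unfold corr; destruct (Rle_dec u (PI / 2)); [lra | reflexivity].
    + unfold dcorr; destruct (Rle_dec w (PI / 2)); [lra | ].
      auto_derive; auto; ring.
Qed.

Section Profile.

Variables phi psi kappa : R -> R.
Hypothesis prof : is_profile phi psi kappa.

Let phi_c := phi_continuous _ _ _ prof.
Let psi_c := psi_continuous _ _ _ prof.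

Definition Pint : R -> R -> R := cos_integral phi.
Definition Jint : R -> R -> R := cos_integral psi.

Lemma phi_scale_derive (x c : R) : 0 < x ->
  is_derive (fun u => phi (u * c)) x (psi (x * c) / x).
Proof.
  intros Hx; destruct (Req_dec c 0) as [-> | Hc].
  - apply (is_derive_ext (fun _ => phi 0)).
    + intros u; now rewrite Rmult_0_r.
    + rewrite Rmult_0_r, (psi_0 _ _ _ prof); unfold Rdiv; rewrite Rmult_0_l.
      apply (is_derive_const (phi 0) x).
  - replace (psi (x * c) / x) with (c * (psi (x * c) / (x * c))) by (field; lra).
    apply (is_derive_comp phi (fun u => u * c)).
    + apply (phi_derive _ _ _ prof); apply Rmult_integral_contrapositive; lra.
    + auto_derive; auto; ring.
Qed.

(** The profile is differentiable only away from 0; since it is continuous with [phi 0 = 0], the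
    factor [y] restores differentiability at 0, which is the point reached at [w = PI / 2]. *)
Lemma id_phi_derive (y : R) : is_derive (fun y => y * phi y) y (phi y + psi y).
Proof.
  destruct (Req_dec y 0) as [-> | Hy].
  - rewrite (phi_0 _ _ _ prof), (psi_0 _ _ _ prof), Rplus_0_r.
    apply (is_derive_0_of_dominated _ (fun u => u) 0 1 (is_derive_id 0)); [ring | ].
    intros e He; destruct (proj1 (filterlim_locally _ _) (phi_c 0) (mkposreal e He)) as [d Hd].
    exists d; intros u Hu; specialize (Hd u Hu).
    change (Rabs (phi u - phi 0) < e) in Hd.
    rewrite (phi_0 _ _ _ prof) in Hd; rewrite !Rminus_0_r in *.
    rewrite Rabs_mult, Rmult_comm; apply Rmult_le_compat_r; [apply Rabs_pos | lra].
  - replace (phi y + psi y) with (1 * phi y + y * (psi y / y)) by (field; auto).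
    apply (is_derive_mult (fun y => y) phi y); [apply (is_derive_id y) | | intros; apply Rmult_comm].
    apply (phi_derive _ _ _ prof); auto.
Qed.

Lemma cos_phi_derive (x w : R) : 0 < x ->
  is_derive (fun w => cos w * phi (x * cos w)) w
    (- sin w * (phi (x * cos w) + psi (x * cos w))).
Proof.
  intros Hx; apply (is_derive_ext (fun w => / x * ((x * cos w) * phi (x * cos w)))).
  { intros u; eqR; field; lra. }
  replace (- sin w * (phi (x * cos w) + psi (x * cos w)))
    with (/ x * ((- (x * sin w)) * (phi (x * cos w) + psi (x * cos w)))) by (field; lra).
  apply (is_derive_scal (fun w => (x * cos w) * phi (x * cos w))).
  apply (is_derive_comp (fun y => y * phi y) (fun w => x * cos w)).
  - apply id_phi_derive.
  - auto_derive; auto; ring.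
Qed.

Lemma Pint_derive_l (x w : R) : 0 < x ->
  is_derive (fun x => Pint x w) x (Jint x w / x).
Proof.
  intros Hx.
  replace (Jint x w / x) with (RInt (fun t => psi (x * cos t) / x) 0 w).
  - assert (Hw : - Rabs w - 1 < 0 < Rabs w + 1) by (pose proof (Rabs_pos w); lra).
    assert (Hw' : - Rabs w - 1 < w < Rabs w + 1).
    { pose proof (Rabs_maj2 w); pose proof (Rle_abs w); lra. }
    apply (is_derive_RInt_param_continuous (fun x t => psi (x * cos t) / x) _ _ 0 Hw) with
      (K := fun x t => phi (x * cos t)); auto.
    + intros u v Hu _; apply continuity_2d_pt_mult.
      * apply continuity_2d_pt_cos_comp, psi_c.
      * apply continuity_2d_pt_inv; [apply continuity_2d_pt_id1 | lra].
    + intros u v Hu _; apply phi_scale_derive; auto.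
    + intros u v Hu _; apply (continuity_2d_pt_section (fun x t => phi (x * cos t))).
      apply continuity_2d_pt_cos_comp, phi_c.
  - unfold Rdiv; rewrite (Rmult_comm (Jint x w)).
    transitivity (RInt (fun t => / x * psi (x * cos t)) 0 w).
    + apply RInt_ext; intros t _; apply Rmult_comm.
    + apply (RInt_scal (V := R_CompleteNormedModule) (fun t => psi (x * cos t)) 0 w (/ x)).
      apply (ex_RInt_interior _ (- Rabs w - 1) (Rabs w + 1)).
      * pose proof (Rabs_pos w); lra.
      * pose proof (Rabs_maj2 w); pose proof (Rle_abs w); lra.
      * intros z _; apply (continuity_2d_pt_section (fun x t => psi (x * cos t))).
        apply continuity_2d_pt_cos_comp, psi_c.
Qed.

(** For [w > PI / 2] and even [phi], [psi] this equals [2 * Gnum x (PI / 2) - Gnum x (PI - w)]: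
    reflecting [Jint] produces [2 * Jint x (PI / 2) * sin w], whence the coefficient [1 - sin w] in
    [corr]. *)
Definition Gnum (x w : R) : R :=
  cos w * phi (x * cos w) + sin w * Jint x w + 2 * Jint x (PI / 2) * corr w.
Definition Gam (x w : R) : R := Gnum x w / phi x.

(** The quotient of the w-derivatives of [Gam] and [Pint], written without dividing by
    [phi (x * cos w)]: [kappa (x * cos w) / x] stands for [Rabs (cos w) / phi (x * cos w)]. The
    angle [PI / 2 - Rabs (w - PI / 2)] is the smaller of [w] and [PI - w], which merges the two
    branches of [corr]. *)
Definition Gratio (x w : R) : R :=
  (- sin w + kappa (x * cos w) / x * Jint x (PI / 2 - Rabs (w - PI / 2))) / phi x.

Definition Gnum_dx (x w : R) : R :=
  cos w * (psi (x * cos w) / x) + sin w * cos_integral_dx psi x w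
  + 2 * cos_integral_dx psi x (PI / 2) * corr w.
Definition Gam_dx (x w : R) : R :=
  (Gnum_dx x w * phi x - Gnum x w * (psi x / x)) / phi x ^ 2.

(** The two [sin w * psi] terms cancel, leaving [- sin w * phi (x * cos w)] and [Rabs (cos w)] times
    [Jint] at the smaller of [w] and [PI - w]. Both are multiples of [phi (x * cos w)], the second
    by [kappa_phi]. *)
Lemma Gam_derive (x w : R) : 0 < x -> 0 < w < PI ->
  is_derive (Gam x) w (Gratio x w * phi (x * cos w)).
Proof.
  intros Hx Hw.
  assert (Hphi : 0 < phi x) by (apply (phi_pos _ _ _ prof); lra).
  assert (E : Gratio x w * phi (x * cos w) = / phi x *
    (- sin w * (phi (x * cos w) + psi (x * cos w))
     + (cos w * Jint x w + sin w * psi (x * cos w)) + 2 * Jint x (PI / 2) * dcorr w)).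
  { unfold Gratio.
    replace ((- sin w + kappa (x * cos w) / x * Jint x (PI / 2 - Rabs (w - PI / 2))) / phi x * phi (x * cos w))
      with (/ phi x * (- sin w * phi (x * cos w)
        + kappa (x * cos w) * phi (x * cos w) * Jint x (PI / 2 - Rabs (w - PI / 2)) / x)) by (field; lra).
    rewrite (kappa_phi _ _ _ prof), Rabs_mult, (Rabs_pos_eq x) by lra.
    f_equal; unfold dcorr; destruct (Rle_dec w (PI / 2)) as [H | H].
    - rewrite (Rabs_left1 (w - PI / 2)) by lra.
      replace (PI / 2 - - (w - PI / 2)) with w by field.
      rewrite (Rabs_pos_eq (cos w)) by (apply cos_ge_0; lra); field; lra.
    - rewrite (Rabs_pos_eq (w - PI / 2)) by lra.
      replace (PI / 2 - (w - PI / 2)) with (PI - w) by field.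
      unfold Jint; rewrite cos_integral_reflect by (auto; apply (psi_even _ _ _ prof)).
      rewrite (Rabs_left1 (cos w)) by (apply cos_le_0; lra); field; lra. }
  rewrite E.
  apply (is_derive_ext (fun w => / phi x * Gnum x w)).
  { intros u; eqR; unfold Gam, Rdiv; ring. }
  apply (is_derive_scal (Gnum x)).
  apply (is_derive_plus (fun w => cos w * phi (x * cos w) + sin w * Jint x w)
    (fun w => 2 * Jint x (PI / 2) * corr w)).
  - apply (is_derive_plus (fun w => cos w * phi (x * cos w)) (fun w => sin w * Jint x w)).
    + apply cos_phi_derive; auto.
    + apply (is_derive_mult sin (Jint x) w); [apply is_derive_sin | | intros; apply Rmult_comm].
      apply cos_integral_derive, psi_c.
  - apply (is_derive_scal corr), corr_derive.
Qed.

Let psi_l := psi_lipschitz _ _ _ prof.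

Lemma Jint_derive_l (x w : R) : 0 < x -> 0 < w < PI ->
  is_derive (fun x => Jint x w) x (cos_integral_dx psi x w).
Proof. apply cos_integral_derive_l; auto. Qed.

Lemma PI2_bounds : 0 < PI / 2 < PI.
Proof. pose proof PI_RGT_0; lra. Qed.

Lemma Gam_derive_l (x w : R) : 0 < x -> 0 < w < PI ->
  is_derive (fun x => Gam x w) x (Gam_dx x w).
Proof.
  intros Hx Hw.
  assert (Hphi : 0 < phi x) by (apply (phi_pos _ _ _ prof); lra).
  apply (is_derive_div (fun x => Gnum x w) phi); [ | apply (phi_derive _ _ _ prof); lra | lra].
  apply (is_derive_plus (fun x => cos w * phi (x * cos w) + sin w * Jint x w)
    (fun x => 2 * Jint x (PI / 2) * corr w)).
  - apply (is_derive_plus (fun x => cos w * phi (x * cos w)) (fun x => sin w * Jint x w)).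
    + apply (is_derive_scal (fun x => phi (x * cos w))), phi_scale_derive; auto.
    + apply (is_derive_scal (fun x => Jint x w)), Jint_derive_l; auto.
  - apply (is_derive_ext (fun x => (2 * corr w) * Jint x (PI / 2))).
    { intros u; eqR; ring. }
    replace (2 * cos_integral_dx psi x (PI / 2) * corr w)
      with ((2 * corr w) * cos_integral_dx psi x (PI / 2)) by ring.
    apply (is_derive_scal (fun x => Jint x (PI / 2))), Jint_derive_l; auto.
    apply PI2_bounds.
Qed.

Let id1 (f : R -> R) (x w : R) : continuous f x -> continuity_2d_pt (fun x _ => f x) x w.
Proof. intros H; apply (continuity_2d_pt_comp1 f (fun x _ => x)); [exact H | apply continuity_2d_pt_id1]. Qed.

Let id2 (f : R -> R) (x w : R) : continuous f w -> continuity_2d_pt (fun _ w => f w) x w.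
Proof. intros H; apply (continuity_2d_pt_comp1 f (fun _ w => w)); [exact H | apply continuity_2d_pt_id2]. Qed.

Lemma inv_phi_continuous (x w : R) : 0 < x -> continuity_2d_pt (fun x _ => / phi x) x w.
Proof.
  intros Hx; apply continuity_2d_pt_inv; [apply id1, phi_c | ].
  apply Rgt_not_eq, (phi_pos _ _ _ prof); lra.
Qed.

Lemma Jint_continuous (x w : R) : 0 < x -> continuity_2d_pt Jint x w.
Proof. apply cos_integral_continuous, psi_c. Qed.

Lemma Gnum_continuous (x w : R) : 0 < x -> continuity_2d_pt Gnum x w.
Proof.
  intros Hx; repeat apply continuity_2d_pt_plus; repeat apply continuity_2d_pt_mult.
  - apply id2, continuous_cos.
  - apply continuity_2d_pt_cos_comp, phi_c.
  - apply id2, continuous_sin.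
  - apply Jint_continuous; auto.
  - apply continuity_2d_pt_const.
  - apply (id1 (fun x => Jint x (PI / 2))), continuity_2d_pt_section_l, Jint_continuous; auto.
  - apply id2; eapply continuous_RtoR_of_derive, corr_derive.
Qed.

Lemma Gam_continuous (x w : R) : 0 < x -> continuity_2d_pt Gam x w.
Proof.
  intros Hx; apply continuity_2d_pt_mult; [apply Gnum_continuous; auto | ].
  apply inv_phi_continuous; auto.
Qed.

Lemma Gratio_continuous (x w : R) : 0 < x -> continuity_2d_pt Gratio x w.
Proof.
  intros Hx; apply continuity_2d_pt_mult; [ | apply inv_phi_continuous; auto].
  apply continuity_2d_pt_plus; [apply (id2 (fun w => - sin w)) | ].
  - apply (continuous_opp sin), continuous_sin.
  - repeat apply continuity_2d_pt_mult.
    + apply continuity_2d_pt_cos_comp, (kappa_continuous _ _ _ prof).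
    + apply (id1 Rinv); apply continuous_Rinv; lra.
    + apply (continuity_2d_pt_comp2 Jint (fun x _ => x) (fun _ w => PI / 2 - Rabs (w - PI / 2))).
      * apply Jint_continuous; auto.
      * apply continuity_2d_pt_id1.
      * apply (id2 (fun w => PI / 2 - Rabs (w - PI / 2))).
        apply (continuous_minus (fun _ => PI / 2) (fun w => Rabs (w - PI / 2))); [apply continuous_const | ].
        apply (continuous_comp (fun w => w - PI / 2) Rabs); [ | apply continuous_Rabs].
        apply (continuous_minus (fun w => w) (fun _ => PI / 2)); [apply continuous_id | apply continuous_const].
Qed.

Lemma Gam_dx_continuous (x w : R) : 0 < x -> 0 < w < PI -> continuity_2d_pt Gam_dx x w.
Proof.
  intros Hx Hw.
  assert (Hinv : continuity_2d_pt (fun x _ => / x) x w).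
  { apply (id1 Rinv), continuous_Rinv; lra. }
  apply continuity_2d_pt_mult.
  - apply continuity_2d_pt_minus.
    + apply continuity_2d_pt_mult; [ | apply id1, phi_c].
      apply continuity_2d_pt_plus; [apply continuity_2d_pt_plus | ].
      * apply continuity_2d_pt_mult; [apply id2, continuous_cos | ].
        apply continuity_2d_pt_mult; [apply continuity_2d_pt_cos_comp, psi_c | exact Hinv].
      * apply continuity_2d_pt_mult; [apply id2, continuous_sin | ].
        apply cos_integral_dx_continuous; auto.
      * apply continuity_2d_pt_mult; [ | apply id2; eapply continuous_RtoR_of_derive, corr_derive].
        apply continuity_2d_pt_mult; [apply continuity_2d_pt_const | ].
        apply (id1 (fun x => cos_integral_dx psi x (PI / 2))), continuity_2d_pt_section_l.
        apply cos_integral_dx_continuous; auto; apply PI2_bounds.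
    + apply continuity_2d_pt_mult; [apply Gnum_continuous; auto | ].
      apply continuity_2d_pt_mult; [apply id1, psi_c | exact Hinv].
  - apply continuity_2d_pt_inv.
    + apply (id1 (fun x => phi x ^ 2)).
      apply (continuous_comp phi (fun y => y ^ 2)); [apply phi_c | ].
      apply (ex_derive_continuous (fun y => y ^ 2)); auto_derive; auto.
    + apply pow_nonzero, Rgt_not_eq, (phi_pos _ _ _ prof); lra.
Qed.

(** The integrand is positive except at [PI / 2], so an interval that contains this angle is cut
    there. *)
Lemma Pint_strict (x w1 w2 : R) : 0 < x -> 0 <= w1 -> w1 < w2 -> w2 <= PI ->
  Pint x w1 < Pint x w2.
Proof.
  intros Hx H1 H12 H2.
  assert (Hd : forall w, is_derive (Pint x) w (phi (x * cos w))).
  { intros w; apply cos_integral_derive, phi_c. }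
  assert (Hstep : forall u v, u < v -> 0 <= u -> v <= PI ->
    (v <= PI / 2 \/ PI / 2 <= u) -> Pint x u < Pint x v).
  { intros u v Huv Hu Hv Hside.
    destruct (MVT_cor2 (Pint x) (fun w => phi (x * cos w)) u v Huv) as [z [E Hz]].
    - intros c _; apply is_derive_Reals, Hd.
    - assert (cos z <> 0).
      { destruct Hside; [apply Rgt_not_eq, cos_gt_0 | apply Rlt_not_eq, cos_lt_0]; lra. }
      assert (0 < phi (x * cos z) * (v - u)).
      { apply Rmult_lt_0_compat; [ | lra].
        apply (phi_pos _ _ _ prof), Rmult_integral_contrapositive; lra. }
      lra. }
  destruct (Rle_lt_dec w2 (PI / 2)); [apply Hstep; auto | ].
  destruct (Rle_lt_dec (PI / 2) w1); [apply Hstep; auto | ].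
  apply Rlt_trans with (Pint x (PI / 2)); apply Hstep; lra.
Qed.

Lemma Pint_PI (x : R) : Pint x PI = 2 * Pint x (PI / 2).
Proof.
  replace PI with (PI - 0) at 1 by ring.
  unfold Pint; rewrite cos_integral_reflect, cos_integral_0; auto; [ring | ].
  apply (phi_even _ _ _ prof).
Qed.

End Profile.

(** * Scale factors *)

Section ScaleFactor.

Variable a : R -> R.
Hypothesis a_reg : regular_scale_factor a.
Variable K C l : R.
Hypothesis a_lower : forall t, 0 < t -> - K <= a t * dda a t / da a t ^ 2.
Hypothesis a_ex3 : forall t, 0 < t -> ex_derive (dda a) t.
Hypothesis a_third : forall t, 0 < t -> Rabs (ddda a t * a t ^ 2 / da a t ^ 3) <= C.
Hypothesis a_speed : filterlim (da a) (at_right 0) (locally l).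

Lemma a_0 : a 0 = 0.
Proof. apply a_reg. Qed.

Lemma a_increasing (s t : R) : 0 <= s -> s < t -> a s < a t.
Proof. apply a_reg. Qed.

Lemma a_pos (t : R) : 0 < t -> 0 < a t.
Proof. intros Ht; rewrite <- a_0; apply a_increasing; lra. Qed.

Lemma a_derive (t : R) : 0 < t -> is_derive a t (da a t).
Proof. intros Ht; apply Derive_correct; now apply a_reg. Qed.

Lemma da_derive (t : R) : 0 < t -> is_derive (da a) t (dda a t).
Proof. intros Ht; apply Derive_correct; now apply a_reg. Qed.

Lemma dda_derive (t : R) : 0 < t -> is_derive (dda a) t (ddda a t).
Proof. intros Ht; apply Derive_correct; now apply a_ex3. Qed.

Lemma da_continuous (t : R) : 0 < t -> continuous (da a) t.
Proof. intros Ht; eapply continuous_RtoR_of_derive, da_derive, Ht. Qed.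

Lemma da_pos (t : R) : 0 < t -> 0 < da a t.
Proof.
  intros Ht; destruct a_reg as (_ & _ & _ & _ & _ & _ & Hd).
  destruct (Hd t Ht) as [Hne _].
  destruct (Rle_lt_dec (da a t) 0) as [Hle | ]; [exfalso | assumption].
  assert (Hder := proj1 (is_derive_Reals _ _ _) (a_derive t Ht)).
  destruct (Hder (- da a t)) as [d Hd']; [lra | ].
  assert (Hd2 := cond_pos d).
  specialize (Hd' (d / 2)).
  rewrite Rabs_pos_eq in Hd' by lra.
  assert (B := Hd' ltac:(lra) ltac:(lra)).
  assert (0 < (a (t + d / 2) - a t) / (d / 2)).
  { apply Rdiv_lt_0_compat; [ | lra].
    assert (a t < a (t + d / 2)) by (apply a_increasing; lra); lra. }
  apply Rabs_def2 in B; lra.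
Qed.

(** The negative of the deceleration parameter of cosmology. *)
Definition accel (t : R) : R := a t * dda a t / da a t ^ 2.

Lemma accel_bounds (t : R) : 0 < t -> - K <= accel t <= 1.
Proof. intros Ht; split; [now apply a_lower | now apply a_reg]. Qed.

Lemma K_lower : -1 <= K.
Proof. pose proof (accel_bounds 1 Rlt_0_1); lra. Qed.

Definition hubble_time (t : R) : R := a t / da a t.

Lemma hubble_time_derive (t : R) : 0 < t -> is_derive hubble_time t (1 - accel t).
Proof.
  intros Ht; pose proof (da_pos t Ht).
  replace (1 - accel t) with ((da a t * da a t - a t * dda a t) / da a t ^ 2)
    by (unfold accel; field; lra).
  apply (is_derive_div a (da a)); [apply a_derive | apply da_derive | ]; lra.
Qed.

(** The bound [accel <= 1] is exactly the nonnegativity of the derivative of a / a'. It lets a bound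
    at one time serve for all earlier times. *)
Lemma hubble_time_mono (s t : R) : 0 < s -> s <= t -> hubble_time s <= hubble_time t.
Proof.
  intros Hs Hst; apply (is_derive_nonneg_le hubble_time (fun t => 1 - accel t)); auto.
  intros z Hz; split; [apply hubble_time_derive; lra | ].
  pose proof (accel_bounds z); lra.
Qed.

(** * The inverse of the scale factor *)

Definition inv_a (y : R) : R := epsilon (inhabits 0) (fun t => 0 <= t /\ a t = y).

Lemma inv_a_spec (y : R) : 0 <= y -> 0 <= inv_a y /\ a (inv_a y) = y.
Proof.
  intros Hy; unfold inv_a; apply epsilon_spec.
  destruct a_reg as (_ & _ & _ & _ & _ & Hs & _); apply Hs, Hy.
Qed.

Lemma a_le_inj (s t : R) : 0 <= s -> 0 <= t -> a s = a t -> s = t.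
Proof.
  intros Hs Ht E; destruct (Rtotal_order s t) as [H | [H | H]]; auto; exfalso.
  - pose proof (a_increasing s t Hs H); lra.
  - pose proof (a_increasing t s Ht H); lra.
Qed.

Lemma inv_a_a (t : R) : 0 <= t -> inv_a (a t) = t.
Proof.
  intros Ht; assert (0 <= a t) by (destruct Ht as [Ht | <-]; [pose proof (a_pos t Ht) | rewrite a_0]; lra).
  destruct (inv_a_spec (a t)) as [H1 H2]; auto; apply a_le_inj; auto.
Qed.

Lemma inv_a_lt (y t : R) : 0 <= y -> 0 <= t -> y < a t -> inv_a y < t.
Proof.
  intros Hy Ht H; destruct (inv_a_spec y Hy) as [H1 H2].
  apply Rnot_le_lt; intros [Hle | Hle].
  - pose proof (a_increasing t _ Ht Hle); lra.
  - rewrite <- Hle in H2; lra.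
Qed.

Lemma lt_inv_a (y t : R) : 0 <= y -> 0 <= t -> a t < y -> t < inv_a y.
Proof.
  intros Hy Ht H; destruct (inv_a_spec y Hy) as [H1 H2].
  apply Rnot_le_lt; intros [Hle | Hle].
  - pose proof (a_increasing _ t H1 Hle); lra.
  - rewrite Hle in H2; lra.
Qed.

Lemma inv_a_pos (y : R) : 0 < y -> 0 < inv_a y.
Proof. intros Hy; apply lt_inv_a; rewrite ?a_0; lra. Qed.

Definition even_inv (y : R) : R := inv_a (Rabs y).

Lemma even_inv_pos (y : R) : y <> 0 -> 0 < even_inv y.
Proof. intros Hy; apply inv_a_pos, Rabs_pos_lt, Hy. Qed.

Lemma even_inv_at_pos (y : R) : 0 < y -> even_inv y = inv_a y.
Proof. intros Hy; unfold even_inv; rewrite Rabs_pos_eq; lra. Qed.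

Lemma even_inv_small (e : R) : 0 < e ->
  locally 0 (fun y => even_inv y < e).
Proof.
  intros He; exists (mkposreal _ (a_pos e He)); intros y Hy.
  change (Rabs (y - 0) < a e) in Hy; rewrite Rminus_0_r in Hy.
  apply inv_a_lt; auto; [apply Rabs_pos | lra].
Qed.

Lemma even_inv_continuous (y : R) : y <> 0 -> continuous even_inv y.
Proof.
  intros Hy; apply (continuous_comp Rabs inv_a); [apply continuous_Rabs | ].
  set (z := Rabs y); assert (Hz : 0 < z) by (apply Rabs_pos_lt, Hy).
  apply filterlim_locally; intros eps.
  destruct (inv_a_spec z) as [H1 H2]; [lra | ].
  pose proof (inv_a_pos z Hz) as H3; set (t := inv_a z) in *.
  set (e := Rmin eps t / 2).
  assert (He : 0 < e < t /\ e < eps).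
  { unfold e; pose proof (Rmin_l eps t); pose proof (Rmin_r eps t).
    assert (0 < Rmin eps t) by (apply Rmin_pos; [apply cond_pos | exact H3]); lra. }
  assert (L1 : a (t - e) < z) by (rewrite <- H2; apply a_increasing; lra).
  assert (L2 : z < a (t + e)) by (rewrite <- H2; apply a_increasing; lra).
  generalize (filter_and _ _ (locally_pos z Hz)
    (filter_and _ _ (open_gt (a (t - e)) z L1) (open_lt (a (t + e)) z L2))).
  apply filter_imp; intros u (Hu & Hu1 & Hu2).
  change (Rabs (inv_a u - t) < eps).
  assert (inv_a u < t + e) by (apply inv_a_lt; lra).
  assert (t - e < inv_a u) by (apply lt_inv_a; lra).
  apply Rabs_def1; lra.
Qed.

(** By the mean value theorem for [a] between the two preimages, the linearisation error is
    [(/ da a z - / da a t) * (s - y)] with [z] between them, and [/ da a] is continuous at [t]. *)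
Lemma even_inv_derive (y : R) : 0 < y -> is_derive even_inv y (/ da a (even_inv y)).
Proof.
  intros Hy; set (t := even_inv y); set (k := / da a t).
  assert (Ht : 0 < t) by (apply even_inv_pos; lra).
  assert (HE : is_derive (fun s => even_inv s - t - k * (s - y)) y 0).
  { apply (is_derive_0_of_dominated _ (fun s => s) y 1 (is_derive_id y));
      [unfold t; ring | ].
    intros e He.
    assert (Hk : continuous (fun s => / da a s) t).
    { apply (continuous_comp (da a) Rinv); [apply da_continuous; auto | ].
      apply continuous_Rinv, Rgt_not_eq, da_pos, Ht. }
    destruct (proj1 (filterlim_locally _ _) Hk (mkposreal e He)) as [d Hd].
    assert (Hc := even_inv_continuous y ltac:(lra)).
    assert (L := proj1 (filterlim_locally _ _) Hc d).
    generalize (filter_and _ _ L (locally_pos y Hy)).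
    apply filter_imp; intros s [Hs Hs0]; change (Rabs (even_inv s - t) < d) in Hs.
    assert (Hu : 0 < even_inv s) by (apply even_inv_pos; lra).
    set (u := even_inv s) in *.
    assert (Eu : a u = s) by (unfold u; rewrite even_inv_at_pos by auto; apply inv_a_spec; lra).
    assert (Et : a t = y) by (unfold t; rewrite even_inv_at_pos by auto; apply inv_a_spec; lra).
    assert (Hz0 : forall z, Rmin t u <= z <= Rmax t u -> 0 < z).
    { intros z; unfold Rmin, Rmax; destruct (Rle_dec t u); lra. }
    destruct (MVT_gen a t u (da a)) as [z [Hz E]].
    - intros z Hz; apply a_derive, Hz0; lra.
    - intros z Hz; apply continuity_pt_filterlim; eapply continuous_RtoR_of_derive, a_derive, Hz0, Hz.
    - rewrite Eu, Et in E.
      pose proof (da_pos z (Hz0 z Hz)) as Hdz.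
      replace (u - t - k * (s - y)) with ((/ da a z - k) * (s - y)).
      + rewrite Rabs_mult; apply Rmult_le_compat_r; [apply Rabs_pos | ].
        left; apply Hd; change (Rabs (z - t) < d).
        apply Rabs_def2 in Hs; unfold Rmin, Rmax in Hz; destruct (Rle_dec t u);
          apply Rabs_def1; lra.
      + rewrite E; field; lra. }
  apply (is_derive_ext (fun s => (even_inv s - t - k * (s - y)) + (k * (s - y) + t))).
  { intros s; eqR; ring. }
  cut (is_derive (fun s => (even_inv s - t - k * (s - y)) + (k * (s - y) + t)) y (0 + k * 1)).
  { now rewrite Rplus_0_l, Rmult_1_r. }
  apply (is_derive_plus (fun s => even_inv s - t - k * (s - y)) (fun s => k * (s - y) + t)); auto.
  auto_derive; auto; ring.
Qed.

(** * The profile of a scale factor *)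

Definition aphi (y : R) : R := hubble_time (even_inv y).
Definition apsi (y : R) : R := aphi y * (1 - accel (even_inv y)).
(** The value at 0 has to be prescribed: [da a 0] would depend on [a] at negative arguments, on
    which nothing is assumed. *)
Definition akappa (y : R) : R := if Req_dec_T y 0 then l else da a (even_inv y).

Lemma even_inv_0 : even_inv 0 = 0.
Proof. unfold even_inv; rewrite Rabs_R0; rewrite <- a_0 at 1; apply inv_a_a; lra. Qed.

Lemma a_even_inv (y : R) : a (even_inv y) = Rabs y.
Proof. apply inv_a_spec, Rabs_pos. Qed.

Lemma aphi_0 : aphi 0 = 0.
Proof. unfold aphi, hubble_time; rewrite even_inv_0, a_0; unfold Rdiv; ring. Qed.

Lemma apsi_0 : apsi 0 = 0.
Proof. unfold apsi; rewrite aphi_0; ring. Qed.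

Lemma aphi_pos (y : R) : y <> 0 -> 0 < aphi y.
Proof.
  intros Hy; unfold aphi, hubble_time; rewrite a_even_inv; apply Rdiv_lt_0_compat.
  - apply Rabs_pos_lt, Hy.
  - apply da_pos, even_inv_pos, Hy.
Qed.

(* If [a / a' >= e] throughout, then [a t * exp (- t / e)] is nonincreasing,
   contradicting [a 0 = 0]. *)
Lemma hubble_time_small (e : R) : 0 < e -> exists t, 0 < t /\ hubble_time t < e.
Proof.
  intros He; apply NNPP; intros H.
  assert (Hall : forall t, 0 < t -> e <= hubble_time t).
  { intros t Ht; apply Rnot_lt_le; intros Hlt; apply H; exists t; auto. }
  set (F := fun t => a t * exp (- t / e)).
  assert (HF : forall t, 0 < t <= 1 -> F 1 <= F t).
  { intros t Ht.
    apply Ropp_le_cancel, (is_derive_nonneg_le (fun t => - F t)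
      (fun t => - (da a t * exp (- t / e) + a t * (- / e * exp (- t / e))))); [lra | ].
    intros z Hz; split.
    - apply (is_derive_opp F).
      apply (is_derive_mult a (fun t => exp (- t / e))); [apply a_derive; lra | | intros; apply Rmult_comm].
      auto_derive; auto; unfold Rdiv; ring.
    - assert (Hz0 : 0 < z) by lra.
      pose proof (da_pos z Hz0) as Hd; pose proof (Hall z Hz0) as Hh.
      unfold hubble_time in Hh; apply Rle_div_r in Hh; [ | exact Hd].
      replace (- (da a z * exp (- z / e) + a z * (- / e * exp (- z / e))))
        with (exp (- z / e) * ((a z - e * da a z) / e)) by (field; lra).
      apply Rmult_le_pos; [left; apply exp_pos | ].
      apply Rle_div_r; lra. }
  assert (HF1 : 0 < F 1) by (apply Rmult_lt_0_compat; [apply a_pos; lra | apply exp_pos]).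
  (* At the time where [a] takes the value [y] one has [F <= y <= F 1 / 2], against [F 1 <= F]. The
     bound [a 1 / 2] places this time before 1. *)
  set (y := Rmin (F 1 / 2) (a 1 / 2)).
  assert (Ha1 : 0 < a 1) by (apply a_pos; lra).
  assert (Hy : 0 < y /\ y <= F 1 / 2 /\ y <= a 1 / 2).
  { unfold y; repeat split; [apply Rmin_pos; lra | apply Rmin_l | apply Rmin_r]. }
  assert (Ht0 : 0 < inv_a y) by (apply inv_a_pos; lra).
  assert (Ht1 : inv_a y < 1) by (apply inv_a_lt; lra).
  specialize (HF (inv_a y) ltac:(lra)); unfold F at 2 in HF.
  destruct (inv_a_spec y) as [_ Ea]; [lra | ]; rewrite Ea in HF.
  assert (exp (- inv_a y / e) <= 1).
  { rewrite <- exp_0; left; apply exp_increasing.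
    apply Rlt_div_l; lra. }
  assert (0 < exp (- inv_a y / e)) by apply exp_pos.
  nra.
Qed.

Lemma aphi_small (e : R) : 0 < e -> locally 0 (fun y => 0 <= aphi y < e).
Proof.
  intros He; destruct (hubble_time_small e He) as [t [Ht Hh]].
  generalize (even_inv_small t Ht); apply filter_imp; intros y Hy.
  destruct (Req_dec y 0) as [-> | H0].
  - rewrite aphi_0; lra.
  - split; [left; apply aphi_pos, H0 | ].
    eapply Rle_lt_trans; [ | exact Hh].
    apply hubble_time_mono; [apply even_inv_pos, H0 | lra].
Qed.

Lemma continuous_even_inv_comp (f : R -> R) (y : R) : y <> 0 ->
  (forall t, 0 < t -> continuous f t) -> continuous (fun y => f (even_inv y)) y.
Proof.
  intros Hy Hf; apply (continuous_comp even_inv f); [apply even_inv_continuous, Hy | ].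
  apply Hf, even_inv_pos, Hy.
Qed.

Lemma aphi_continuous (y : R) : continuous aphi y.
Proof.
  destruct (Req_dec y 0) as [-> | Hy].
  - apply filterlim_locally; intros eps.
    generalize (aphi_small eps (cond_pos eps)); apply filter_imp; intros u Hu.
    change (Rabs (aphi u - aphi 0) < eps); rewrite aphi_0, Rminus_0_r, Rabs_pos_eq; lra.
  - apply (continuous_even_inv_comp hubble_time); auto.
    intros t Ht; eapply continuous_RtoR_of_derive, hubble_time_derive, Ht.
Qed.

Definition daccel (t : R) : R :=
  ((da a t * dda a t + a t * ddda a t) * da a t ^ 2
   - a t * dda a t * (2 * da a t * dda a t)) / (da a t ^ 2) ^ 2.

Lemma accel_derive (t : R) : 0 < t -> is_derive accel t (daccel t).
Proof.
  intros Ht; pose proof (da_pos t Ht).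
  apply (is_derive_div (fun t => a t * dda a t) (fun t => da a t ^ 2)).
  - apply (is_derive_mult a (dda a)); [apply a_derive; auto | apply dda_derive; auto | intros; apply Rmult_comm].
  - replace (2 * da a t * dda a t) with (dda a t * (2 * da a t)) by ring.
    apply (is_derive_comp (fun y => y ^ 2) (da a)); [ | apply da_derive; auto].
    auto_derive; auto; ring.
  - apply pow_nonzero; lra.
Qed.

Lemma apsi_continuous (y : R) : continuous apsi y.
Proof.
  destruct (Req_dec y 0) as [-> | Hy].
  - apply filterlim_locally; intros eps.
    (* [1 - accel] lies between 0 and [1 + K], so [apsi] vanishes at 0 along with [aphi]; [2 + K] is
       a strictly positive bound. *)
    assert (He : 0 < eps / (2 + K)).
    { apply Rdiv_lt_0_compat; [apply cond_pos | pose proof K_lower; lra]. }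
    generalize (aphi_small _ He); apply filter_imp; intros u Hu.
    change (Rabs (apsi u - apsi 0) < eps); rewrite apsi_0, Rminus_0_r.
    destruct (Req_dec u 0) as [-> | H0]; [rewrite apsi_0, Rabs_R0; apply cond_pos | ].
    unfold apsi; pose proof (accel_bounds (even_inv u) (even_inv_pos u H0)) as Hq.
    rewrite Rabs_pos_eq by (apply Rmult_le_pos; lra).
    apply Rle_lt_trans with (aphi u * (2 + K)).
    + apply Rmult_le_compat_l; lra.
    + apply Rlt_div_r; [pose proof K_lower; lra | lra].
  - apply (continuous_mult aphi (fun y => 1 - accel (even_inv y))); [apply aphi_continuous | ].
    apply (continuous_even_inv_comp (fun t => 1 - accel t)); auto.
    intros t Ht; apply (continuous_minus (fun _ => 1) accel); [apply continuous_const | ].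
    eapply continuous_RtoR_of_derive, accel_derive, Ht.
Qed.

Lemma akappa_continuous (y : R) : continuous akappa y.
Proof.
  destruct (Req_dec y 0) as [-> | Hy].
  - apply filterlim_locally; intros eps.
    destruct (proj1 (filterlim_locally _ _) a_speed eps) as [d Hd].
    generalize (even_inv_small d (cond_pos d)); apply filter_imp; intros u Hu.
    change (Rabs (akappa u - akappa 0) < eps); unfold akappa.
    destruct (Req_dec_T 0 0) as [_ | ]; [ | lra].
    destruct (Req_dec_T u 0) as [_ | H0].
    + rewrite Rminus_eq_0, Rabs_R0; apply cond_pos.
    + pose proof (even_inv_pos u H0); apply Hd; auto.
      change (Rabs (even_inv u - 0) < d); rewrite Rabs_pos_eq; lra.
  - apply (continuous_ext_loc _ (fun y => da a (even_inv y))).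
    + generalize (open_neq 0 y Hy); apply filter_imp; intros u Hu.
      unfold akappa; destruct (Req_dec_T u 0); [contradiction | reflexivity].
    + apply continuous_even_inv_comp; auto; apply da_continuous.
Qed.

Lemma aphi_derive_pos (y : R) : 0 < y -> is_derive aphi y (apsi y / y).
Proof.
  intros Hy; pose proof (even_inv_pos y ltac:(lra)) as Ht; pose proof (da_pos _ Ht).
  replace (apsi y / y) with (/ da a (even_inv y) * (1 - accel (even_inv y))).
  - apply (is_derive_comp hubble_time even_inv); [apply hubble_time_derive, Ht | apply even_inv_derive, Hy].
  - unfold apsi, aphi, hubble_time; rewrite a_even_inv, Rabs_pos_eq by lra; field; lra.
Qed.

Lemma even_inv_opp (y : R) : even_inv (- y) = even_inv y.
Proof. unfold even_inv; now rewrite Rabs_Ropp. Qed.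

Lemma aphi_derive (y : R) : y <> 0 -> is_derive aphi y (apsi y / y).
Proof.
  intros Hy; destruct (Rlt_le_dec 0 y) as [H | H]; [now apply aphi_derive_pos | ].
  apply (is_derive_ext (fun y => aphi (- y))).
  { intros u; unfold aphi; now rewrite even_inv_opp. }
  replace (apsi y / y) with (-1 * (apsi (- y) / (- y))).
  - apply (is_derive_comp aphi Ropp); [apply aphi_derive_pos; lra | ].
    auto_derive; auto; ring.
  - unfold apsi, aphi; rewrite even_inv_opp; field; auto.
Qed.

Lemma apsi_derive_pos (y : R) : 0 < y ->
  is_derive apsi y (/ da a (even_inv y) *
    ((1 - accel (even_inv y)) * (1 - accel (even_inv y)) - hubble_time (even_inv y) * daccel (even_inv y))).
Proof.
  intros Hy; pose proof (even_inv_pos y ltac:(lra)) as Ht.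
  apply (is_derive_comp (fun t => hubble_time t * (1 - accel t)) even_inv); [ | apply even_inv_derive, Hy].
  set (t := even_inv y) in *.
  replace ((1 - accel t) * (1 - accel t) - hubble_time t * daccel t)
    with ((1 - accel t) * (1 - accel t) + hubble_time t * (0 - daccel t)) by ring.
  apply (is_derive_mult hubble_time (fun t => 1 - accel t)); [apply hubble_time_derive, Ht | | intros; apply Rmult_comm].
  apply (is_derive_minus (fun _ => 1) accel); [apply (is_derive_const 1 t) | apply accel_derive, Ht].
Qed.

(** With [q = accel t] the expression is [1 - 3 q + 3 q ^ 2] minus the quantity bounded by [C]. The
    quadratic is convex and positive, and its values 1 at [q = 1] and [1 + 3 K + 3 K ^ 2] at
    [q = - K] are below [3 (2 + K) ^ 2] since [K >= -1]. *)
Lemma apsi_slope_bound (t : R) : 0 < t ->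
  Rabs ((1 - accel t) * (1 - accel t) - hubble_time t * daccel t) <= 3 * (2 + K) * (2 + K) + C.
Proof.
  intros Ht; pose proof (da_pos t Ht).
  replace ((1 - accel t) * (1 - accel t) - hubble_time t * daccel t)
    with ((1 - 3 * accel t + 3 * accel t * accel t) + - (ddda a t * a t ^ 2 / da a t ^ 3))
    by (unfold accel, daccel, hubble_time; field; lra).
  eapply Rle_trans; [apply Rabs_triang | rewrite Rabs_Ropp; apply Rplus_le_compat; [ | now apply a_third]].
  pose proof (accel_bounds t Ht); pose proof K_lower; apply Rabs_le; nra.
Qed.

(** The derivative of [apsi] contains the third derivative of [a] and need not be continuous, so its
    bound is used through the mean value theorem. The constant is a local bound for 1 / a' times the
    slope bound, hence only local in [y]. *)
Lemma apsi_lipschitz (y : R) : 0 < y -> exists L d, 0 <= L /\ 0 < d /\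
  forall y1 y2, Rabs (y1 - y) < d -> Rabs (y2 - y) < d ->
    Rabs (apsi y1 - apsi y2) <= L * Rabs (y1 - y2).
Proof.
  intros Hy; set (k := fun y => / da a (even_inv y)).
  assert (Hk : continuous k y).
  { apply (continuous_even_inv_comp (fun t => / da a t)); [lra | ]; intros t Ht.
    apply (continuous_comp (da a) Rinv); [apply da_continuous, Ht | ].
    apply continuous_Rinv, Rgt_not_eq, da_pos, Ht. }
  destruct (continuous_local_bound k y Hk) as [d [Hd HB]].
  set (M := 3 * (2 + K) * (2 + K) + C).
  assert (HM : 0 <= M).
  { eapply Rle_trans; [apply Rabs_pos | apply (apsi_slope_bound 1 Rlt_0_1)]. }
  assert (Hk0 : 0 <= Rabs (k y) + 1) by (pose proof (Rabs_pos (k y)); lra).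
  exists ((Rabs (k y) + 1) * M), (Rmin d (y / 2)).
  split; [apply Rmult_le_pos; auto | split; [apply Rmin_pos; lra | ]].
  intros y1 y2 H1 H2.
  apply Rmin_Rgt_l in H1; apply Rmin_Rgt_l in H2.
  destruct H1 as [H1 H1'], H2 as [H2 H2'].
  apply Rgt_lt, Rabs_lt_pos in H1'; apply Rgt_lt, Rabs_lt_pos in H2'; auto.
  assert (Hz0 : forall z, Rmin y2 y1 <= z <= Rmax y2 y1 -> 0 < z /\ Rabs (z - y) < d).
  { intros z Hz; apply Rgt_lt, Rabs_def2 in H1; apply Rgt_lt, Rabs_def2 in H2.
    unfold Rmin, Rmax in Hz; destruct (Rle_dec y2 y1); (split; [ | apply Rabs_def1]); lra. }
  destruct (MVT_gen apsi y2 y1 (fun z => k z * ((1 - accel (even_inv z)) * (1 - accel (even_inv z))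
      - hubble_time (even_inv z) * daccel (even_inv z)))) as [z [Hz E]].
  - intros z Hz; apply apsi_derive_pos, Hz0; lra.
  - intros z Hz; apply continuity_pt_filterlim, apsi_continuous.
  - rewrite E, !Rabs_mult; destruct (Hz0 z Hz) as [Hz1 Hz2].
    apply Rmult_le_compat_r; [apply Rabs_pos | ].
    rewrite <- Rabs_mult; fold (k z); rewrite Rabs_mult.
    apply Rmult_le_compat; try apply Rabs_pos; [now apply HB | ].
    apply apsi_slope_bound, even_inv_pos; lra.
Qed.

Lemma a_profile : is_profile aphi apsi akappa.
Proof.
  constructor.
  - intros y; unfold aphi; now rewrite even_inv_opp.
  - intros y; unfold apsi, aphi; now rewrite even_inv_opp.
  - exact aphi_continuous.
  - exact apsi_continuous.
  - exact akappa_continuous.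
  - exact aphi_0.
  - exact apsi_0.
  - exact aphi_pos.
  - intros y; unfold akappa; destruct (Req_dec_T y 0) as [-> | Hy].
    + rewrite aphi_0, Rabs_R0; ring.
    + unfold aphi, hubble_time; rewrite a_even_inv; field.
      apply Rgt_not_eq, da_pos, even_inv_pos, Hy.
  - exact aphi_derive.
  - exact apsi_lipschitz.
Qed.

(** * The odd extension of the scale factor and the angle *)

(** Unlike the even extension [ae], which is its absolute value, it is strictly increasing through
    0, so the angle distinguishes [t] from [- t]. *)
Definition odd_a (t : R) : R := if Rle_dec 0 t then a t else - a (- t).
Definition odd_speed (t : R) : R := if Req_dec_T t 0 then l else da a (Rabs t).

Lemma odd_a_pos (t : R) : 0 <= t -> odd_a t = a t.
Proof. intros Ht; unfold odd_a; destruct (Rle_dec 0 t); [reflexivity | contradiction]. Qed.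

Lemma odd_a_opp (t : R) : odd_a (- t) = - odd_a t.
Proof.
  unfold odd_a; destruct (Rle_dec 0 (- t)), (Rle_dec 0 t); try lra.
  - replace t with 0 by lra; rewrite Ropp_0, a_0; ring.
  - now rewrite Ropp_involutive.
Qed.

Lemma odd_a_0 : odd_a 0 = 0.
Proof. rewrite odd_a_pos by lra; apply a_0. Qed.

Lemma Rabs_odd_a (t : R) : Rabs (odd_a t) = ae a t.
Proof.
  unfold ae, odd_a; destruct (Rle_dec 0 t) as [H | H].
  - rewrite (Rabs_pos_eq t) by lra; apply Rabs_pos_eq.
    destruct H as [H | <-]; [left; apply a_pos, H | rewrite a_0; lra].
  - rewrite Rabs_Ropp, (Rabs_left t) by lra; apply Rabs_pos_eq.
    left; apply a_pos; lra.
Qed.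

Lemma odd_a_increasing (s t : R) : s < t -> odd_a s < odd_a t.
Proof.
  intros H; unfold odd_a; destruct (Rle_dec 0 s), (Rle_dec 0 t); try lra.
  - apply a_increasing; lra.
  - assert (0 < a (- s)) by (apply a_pos; lra).
    assert (0 <= a t) by (apply a_reg; lra); lra.
  - apply Ropp_lt_contravar, a_increasing; lra.
Qed.

Lemma a_continuous_right_0 : filterlim a (at_right 0) (locally 0).
Proof.
  destruct a_reg as (_ & _ & _ & Hc & _).
  specialize (Hc 0 (Rle_refl 0)); rewrite a_0 in Hc.
  apply filterlim_locally; intros eps.
  destruct (proj1 (filterlim_locally _ _) Hc eps) as [d Hd].
  exists d; intros u Hu Hu0; apply Hd; auto; lra.
Qed.

Lemma odd_a_continuous (t : R) : continuous odd_a t.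
Proof.
  destruct (total_order_T t 0) as [[H | ->] | H].
  - apply (continuous_ext_loc _ (fun t => - a (- t))).
    + generalize (open_lt 0 t H); apply filter_imp; intros u Hu.
      unfold odd_a; destruct (Rle_dec 0 u); [lra | reflexivity].
    + apply (continuous_opp (fun t => a (- t))), (continuous_comp Ropp a).
      * apply (ex_derive_continuous Ropp); auto_derive; auto.
      * eapply continuous_RtoR_of_derive, a_derive; lra.
  - apply filterlim_locally; intros eps.
    destruct (proj1 (filterlim_locally _ _) a_continuous_right_0 eps) as [d Hd].
    exists d; intros u Hu.
    change (Rabs (u - 0) < d) in Hu; rewrite Rminus_0_r in Hu.
    change (Rabs (odd_a u - odd_a 0) < eps); rewrite odd_a_0, Rminus_0_r, Rabs_odd_a.
    destruct (Req_dec u 0) as [-> | H0].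
    + unfold ae; rewrite Rabs_R0, a_0; apply cond_pos.
    + assert (B := Hd (Rabs u)); change (Rabs (Rabs u - 0) < d -> 0 < Rabs u ->
        Rabs (a (Rabs u) - 0) < eps) in B.
      rewrite !Rminus_0_r, Rabs_Rabsolu in B.
      eapply Rle_lt_trans; [apply Rle_abs | apply B; auto; apply Rabs_pos_lt, H0].
  - apply (continuous_ext_loc _ a).
    + generalize (open_gt 0 t H); apply filter_imp; intros u Hu.
      symmetry; apply odd_a_pos; lra.
    + eapply continuous_RtoR_of_derive, a_derive, H.
Qed.

Lemma odd_a_derive_pos (t : R) : 0 < t -> is_derive odd_a t (odd_speed t).
Proof.
  intros H; apply (is_derive_ext_loc a).
  - generalize (open_gt 0 t H); apply filter_imp; intros u Hu.
    symmetry; apply odd_a_pos; lra.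
  - unfold odd_speed; destruct (Req_dec_T t 0); [lra | ].
    rewrite Rabs_pos_eq by lra; apply a_derive, H.
Qed.

Lemma odd_speed_opp (t : R) : odd_speed (- t) = odd_speed t.
Proof.
  unfold odd_speed; rewrite Rabs_Ropp; destruct (Req_dec_T (- t) 0), (Req_dec_T t 0); auto; lra.
Qed.

Lemma odd_a_increment (e : R) : 0 < e ->
  exists d, 0 < d /\ forall u, 0 <= u < d -> Rabs (odd_a u - l * u) <= e * u.
Proof.
  intros He; destruct (proj1 (filterlim_locally _ _) a_speed (mkposreal e He)) as [d Hd].
  exists d; split; [apply cond_pos | ]; intros u Hu.
  destruct (MVT_gen odd_a 0 u odd_speed) as [z [Hz E]];
    rewrite ?Rmin_left, ?Rmax_right in * by lra.
  - intros z Hz; apply odd_a_derive_pos; lra.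
  - intros z _; apply continuity_pt_filterlim, odd_a_continuous.
  - rewrite odd_a_0, !Rminus_0_r in E; rewrite E.
    replace (odd_speed z * u - l * u) with ((odd_speed z - l) * u) by ring.
    rewrite Rabs_mult, (Rabs_pos_eq u) by lra; apply Rmult_le_compat_r; [lra | ].
    (* The intermediate point may be the endpoint 0, where [odd_speed] is [l] by definition. *)
    unfold odd_speed; destruct (Req_dec_T z 0) as [_ | H0].
    + rewrite Rminus_eq_0, Rabs_R0; lra.
    + rewrite (Rabs_pos_eq z) by lra; left; apply Hd; [ | lra].
      change (Rabs (z - 0) < d); rewrite Rabs_pos_eq; lra.
Qed.

(** At 0 the right derivative is the limit [l] of a', and oddness makes the left derivative agree
    with it. Hence the substitution passes through [t = 0] without a case split. *)
Lemma odd_a_derive (t : R) : is_derive odd_a t (odd_speed t).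
Proof.
  destruct (total_order_T t 0) as [[H | ->] | H].
  - apply (is_derive_ext (fun t => - odd_a (- t))).
    { intros u; eqR; rewrite odd_a_opp; ring. }
    rewrite <- odd_speed_opp.
    replace (odd_speed (- t)) with (- (-1 * odd_speed (- t))) by ring.
    apply (is_derive_opp (fun t => odd_a (- t))).
    apply (is_derive_comp odd_a Ropp); [apply odd_a_derive_pos; lra | ].
    auto_derive; auto; ring.
  - replace (odd_speed 0) with l by (unfold odd_speed; destruct (Req_dec_T 0 0); lra).
    cut (is_derive (fun t => (odd_a t - l * t) + l * t) 0 (0 + l)).
    { intros HH; rewrite Rplus_0_l in HH; revert HH; apply is_derive_ext; intros; eqR; ring. }
    apply (is_derive_plus (fun t => odd_a t - l * t) (fun t => l * t));
      [ | auto_derive; auto; ring].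
    apply (is_derive_0_of_dominated _ (fun u => u) 0 1 (is_derive_id 0));
      [rewrite odd_a_0; ring | ].
    intros e He; destruct (odd_a_increment e He) as [d [Hd HB]].
    exists (mkposreal d Hd); intros u Hu.
    change (Rabs (u - 0) < d) in Hu; rewrite Rminus_0_r in *.
    destruct (Rle_dec 0 u) as [Hu0 | Hu0].
    + rewrite (Rabs_pos_eq u) in * by lra; apply HB; lra.
    + rewrite (Rabs_left u) in * by lra.
      replace (odd_a u - l * u) with (- (odd_a (- u) - l * (- u))) by (rewrite odd_a_opp; ring).
      rewrite Rabs_Ropp; apply HB; lra.
  - apply odd_a_derive_pos, H.
Qed.

(** The Jacobian identity of the substitution: it turns [aphi (A * cos x) dx] into the integrand
    that defines rho, also at [t = 0], where both sides vanish. *)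
Lemma aphi_odd_a (t : R) : aphi (odd_a t) * odd_speed t = ae a t.
Proof.
  unfold odd_speed; destruct (Req_dec_T t 0) as [-> | H].
  - rewrite odd_a_0, aphi_0; unfold ae; rewrite Rabs_R0, a_0; ring.
  - unfold aphi, hubble_time, even_inv; rewrite Rabs_odd_a; unfold ae.
    rewrite inv_a_a by apply Rabs_pos.
    field; apply Rgt_not_eq, da_pos, Rabs_pos_lt, H.
Qed.

Definition angle (tau t : R) : R := acos (odd_a t / a tau).

Lemma odd_a_ratio (tau t : R) : 0 < tau -> - tau < t < tau -> -1 < odd_a t / a tau < 1.
Proof.
  intros Htau Ht; pose proof (a_pos tau Htau).
  assert (E : a tau = odd_a tau) by (symmetry; apply odd_a_pos; lra).
  assert (odd_a t < a tau) by (rewrite E; apply odd_a_increasing; lra).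
  assert (- a tau < odd_a t) by (rewrite E, <- odd_a_opp; apply odd_a_increasing; lra).
  split; [apply Rlt_div_r | apply Rlt_div_l]; lra.
Qed.

Lemma angle_bounds (tau t : R) : 0 < tau -> - tau < t < tau -> 0 < angle tau t < PI.
Proof. intros; apply acos_bound_lt, odd_a_ratio; auto. Qed.

Lemma cos_angle (tau t : R) : 0 < tau -> - tau < t < tau ->
  a tau * cos (angle tau t) = odd_a t.
Proof.
  intros H1 H2; unfold angle; pose proof (odd_a_ratio tau t H1 H2).
  rewrite cos_acos by lra; field; apply Rgt_not_eq, a_pos, H1.
Qed.

Lemma sin_angle (tau t : R) : 0 < tau -> - tau < t < tau ->
  a tau * sin (angle tau t) = sqrt (a tau ^ 2 - ae a t ^ 2).
Proof.
  intros H1 H2; pose proof (angle_bounds tau t H1 H2) as Hw; pose proof (a_pos tau H1).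
  assert (0 < sin (angle tau t)) by (apply sin_gt_0; lra).
  symmetry; apply sqrt_lem_1.
  - rewrite <- Rabs_odd_a, pow2_abs.
    rewrite <- (cos_angle tau t H1 H2); pose proof (COS_bound (angle tau t)).
    assert (0 <= a tau ^ 2 * (1 - cos (angle tau t) ^ 2)).
    { apply Rmult_le_pos; [apply pow2_ge_0 | nra]. }
    lra.
  - apply Rmult_le_pos; lra.
  - rewrite <- Rabs_odd_a, pow2_abs, <- (cos_angle tau t H1 H2).
    pose proof (sin2_cos2 (angle tau t)) as E; unfold Rsqr in E.
    replace (a tau * sin (angle tau t) * (a tau * sin (angle tau t)))
      with (a tau ^ 2 * (sin (angle tau t) * sin (angle tau t))) by ring.
    replace (sin (angle tau t) * sin (angle tau t))
      with (1 - cos (angle tau t) * cos (angle tau t)) by lra; ring.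
Qed.

Lemma acos_is_derive (x : R) : -1 < x < 1 -> is_derive acos x (- / sin (acos x)).
Proof.
  intros Hx; apply is_derive_Reals.
  pose proof (derive_pt_acos x Hx) as E.
  apply (derive_pt_eq_1 _ _ _ (derivable_pt_acos x Hx)).
  rewrite E, sin_acos by lra; unfold Rdiv; ring.
Qed.

Lemma angle_derive (tau t : R) : 0 < tau -> - tau < t < tau ->
  is_derive (angle tau) t (- odd_speed t / sqrt (a tau ^ 2 - ae a t ^ 2)).
Proof.
  intros H1 H2; pose proof (a_pos tau H1).
  pose proof (angle_bounds tau t H1 H2) as Hw.
  assert (0 < sin (angle tau t)) by (apply sin_gt_0; lra).
  rewrite <- sin_angle by auto.
  replace (- odd_speed t / (a tau * sin (angle tau t)))
    with ((/ a tau * odd_speed t) * (- / sin (angle tau t))) by (field; lra).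
  apply (is_derive_comp acos (fun t => odd_a t / a tau)).
  - apply acos_is_derive, odd_a_ratio; auto.
  - apply (is_derive_ext (fun t => / a tau * odd_a t)).
    { intros u; eqR; apply Rmult_comm. }
    apply (is_derive_scal odd_a), odd_a_derive.
Qed.

Lemma angle_0 (tau : R) : angle tau 0 = PI / 2.
Proof. unfold angle, Rdiv; rewrite odd_a_0, Rmult_0_l; apply acos_0. Qed.

Lemma angle_opp (tau t : R) : angle tau (- t) = PI - angle tau t.
Proof. unfold angle; rewrite odd_a_opp, <- acos_opp; f_equal; unfold Rdiv; ring. Qed.

(** The arc cosine is not differentiable at 1, so the limit comes from continuity of [odd_a] and
    monotonicity of the cosine. *)
Lemma angle_left_limit (tau : R) : 0 < tau -> filterlim (angle tau) (at_left tau) (locally 0).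
Proof.
  intros Htau; apply filterlim_locally; intros eps.
  pose proof (a_pos tau Htau) as Ha; pose proof PI_RGT_0.
  set (e := Rmin eps PI / 2).
  assert (He : 0 < e /\ e < eps /\ e < PI).
  { assert (0 < Rmin eps PI) by (apply Rmin_pos; [apply cond_pos | lra]).
    unfold e; pose proof (Rmin_l eps PI); pose proof (Rmin_r eps PI); lra. }
  assert (Hc : a tau * cos e < odd_a tau).
  { rewrite odd_a_pos by lra.
    assert (cos e < 1) by (rewrite <- cos_0; apply cos_decreasing_1; lra); nra. }
  assert (L : locally tau (fun t => a tau * cos e < odd_a t)).
  { exact (odd_a_continuous tau _ (open_gt _ _ Hc)). }
  generalize (filter_and _ _ L (open_gt (- tau) tau ltac:(lra))).
  intros [d Hd]; exists d; intros t Ht Htt.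
  destruct (Hd t Ht) as [H1 H2].
  change (Rabs (angle tau t - 0) < eps).
  pose proof (angle_bounds tau t Htau ltac:(lra)) as Hw.
  rewrite Rminus_0_r, Rabs_pos_eq by lra.
  apply Rnot_le_lt; intros Hle.
  rewrite <- (cos_angle tau t) in H1 by lra.
  apply Rmult_lt_reg_l in H1; [ | exact Ha].
  assert (cos (angle tau t) <= cos e) by (apply cos_decr_1; lra); lra.
Qed.

(** * Evaluation of the improper integrals in terms of the angle *)

Lemma iint_primitive (f F : R -> R) (x y lx ly : R) : x < y ->
  (forall t, x < t < y -> is_derive F t (f t) /\ continuous f t) ->
  filterlim F (at_right x) (locally lx) -> filterlim F (at_left y) (locally ly) ->
  iint f x y = ly - lx.
Proof.
  intros Hxy HF Hx Hy; unfold iint.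
  apply (is_RInt_gen_unique (V := R_CompleteNormedModule)).
  assert (Hprod : filter_prod (at_right x) (at_left y)
    (fun ab : R * R => x < fst ab < y /\ x < snd ab < y)).
  { exists (fun t => x < t < y) (fun t => x < t < y); [ | | intros; simpl; auto].
    - assert (H : 0 < y - x) by lra; exists (mkposreal _ H); intros t Ht Htx.
      change (Rabs (t - x) < y - x) in Ht; apply Rabs_def2 in Ht; lra.
    - assert (H : 0 < y - x) by lra; exists (mkposreal _ H); intros t Ht Htx.
      change (Rabs (t - y) < y - x) in Ht; apply Rabs_def2 in Ht; lra. }
  assert (Hin : forall u v t, x < u < y -> x < v < y -> Rmin u v <= t <= Rmax u v -> x < t < y).
  { intros u v t; unfold Rmin, Rmax; destruct (Rle_dec u v); lra. }
  apply (is_RInt_gen_ext (Derive F)).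
  - revert Hprod; apply filter_imp; intros [u v] [Hu Hv] t Ht; simpl in *.
    apply is_derive_unique, HF, (Hin u v); auto; lra.
  - apply is_RInt_gen_Derive; auto.
    + revert Hprod; apply filter_imp; intros [u v] [Hu Hv] t Ht; simpl in *.
      eexists; apply HF, (Hin u v); auto.
    + revert Hprod; apply filter_imp; intros [u v] [Hu Hv] t Ht; simpl in *.
      assert (Ht' : x < t < y) by (apply (Hin u v); auto).
      apply (continuous_ext_loc _ f); [ | apply HF, Ht'].
      generalize (filter_and _ _ (open_gt x t (proj1 Ht')) (open_lt y t (proj2 Ht'))).
      apply filter_imp; intros s Hs; symmetry; apply is_derive_unique, HF, Hs.
Qed.

Lemma filterlim_at_right_of_continuous (F : R -> R) (x : R) :
  continuous F x -> filterlim F (at_right x) (locally (F x)).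
Proof.
  intros H Q HQ; specialize (H Q HQ); unfold filtermap in *.
  revert H; apply filter_le_within.
Qed.

Lemma continuous_of_interior_eq (f g : R -> R) (x y t : R) :
  (forall s, x < s < y -> f s = g s) -> x < t < y -> continuous f t -> continuous g t.
Proof.
  intros H Ht; apply continuous_ext_loc.
  generalize (filter_and _ _ (open_gt x t (proj1 Ht)) (open_lt y t (proj2 Ht))).
  apply filter_imp; intros s Hs; apply H, Hs.
Qed.

Lemma inv_sqrt_gap_continuous (tau t : R) : 0 < tau -> - tau < t < tau ->
  continuous (fun t => / sqrt (a tau ^ 2 - ae a t ^ 2)) t.
Proof.
  intros H1 H2.
  apply (continuous_of_interior_eq (fun t => / (a tau * sin (angle tau t))) _ (- tau) tau); auto.
  { intros s Hs; now rewrite sin_angle. }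
  pose proof (a_pos tau H1).
  assert (0 < sin (angle tau t)) by (apply sin_gt_0; apply angle_bounds; auto).
  apply (continuous_comp (angle tau) (fun w => / (a tau * sin w))).
  - eapply continuous_RtoR_of_derive, angle_derive; auto.
  - apply (ex_derive_continuous (fun w => / (a tau * sin w))); auto_derive; nra.
Qed.

Let P := Pint aphi.
Let J := Jint apsi.

(** The integrand is kept general so that one computation serves both [rho_of], written with [ae],
    and [rhoM], written with [a]. *)
Lemma rho_of_integral (tau s : R) (f : R -> R) : 0 < tau -> - tau < s < tau ->
  (forall t, s < t < tau -> f t = ae a t / sqrt (a tau ^ 2 - ae a t ^ 2)) ->
  iint f s tau = P (a tau) (angle tau s).
Proof.
  intros Htau Hs Hf.
  assert (HP : forall w, is_derive (P (a tau)) w (aphi (a tau * cos w))).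
  { intros w; apply cos_integral_derive, aphi_continuous. }
  assert (HF : forall t, - tau < t < tau -> is_derive (fun t => - P (a tau) (angle tau t)) t
    (ae a t / sqrt (a tau ^ 2 - ae a t ^ 2))).
  { intros t Ht.
    replace (ae a t / sqrt (a tau ^ 2 - ae a t ^ 2))
      with (- ((- odd_speed t / sqrt (a tau ^ 2 - ae a t ^ 2)) * aphi (a tau * cos (angle tau t)))).
    2:{ rewrite cos_angle by auto; unfold Rdiv; rewrite <- (aphi_odd_a t) at 2; ring. }
    apply (is_derive_opp (fun t => P (a tau) (angle tau t))).
    apply (is_derive_comp (P (a tau)) (angle tau)); [apply HP | apply angle_derive; auto]. }
  replace (P (a tau) (angle tau s)) with (0 - - P (a tau) (angle tau s)) by ring.
  apply (iint_primitive f (fun t => - P (a tau) (angle tau t))); [lra | | | ].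
  - intros t Ht; rewrite Hf by auto; split; [apply HF; lra | ].
    apply (continuous_of_interior_eq (fun t => ae a t / sqrt (a tau ^ 2 - ae a t ^ 2)) _ s tau); auto.
    { intros; symmetry; auto. }
    apply (continuous_mult (fun t => ae a t) (fun t => / sqrt (a tau ^ 2 - ae a t ^ 2))).
    + apply (continuous_ext (fun t => Rabs (odd_a t))); [apply Rabs_odd_a | ].
      apply (continuous_comp odd_a Rabs); [apply odd_a_continuous | apply continuous_Rabs].
    + apply inv_sqrt_gap_continuous; lra.
  - apply (filterlim_at_right_of_continuous (fun t => - P (a tau) (angle tau t))).
    eapply continuous_RtoR_of_derive, HF; auto.
  - replace 0 with (- P (a tau) 0) by (unfold P, Pint; rewrite cos_integral_0; ring).
    apply (filterlim_comp _ _ _ (angle tau) (fun w => - P (a tau) w) _ (locally 0));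
      [apply angle_left_limit, Htau | ].
    apply (continuous_opp (P (a tau))); eapply continuous_RtoR_of_derive, HP.
Qed.

Lemma rho_of_eq (tau s : R) : 0 < tau -> - tau < s < tau ->
  rho_of a tau s = P (a tau) (angle tau s).
Proof. intros; apply rho_of_integral; auto. Qed.

Lemma rhoM_eq (tau : R) : 0 < tau -> rhoM a tau = P (a tau) (PI / 2).
Proof.
  intros Htau; rewrite <- (angle_0 tau); unfold rhoM.
  apply (rho_of_integral tau 0); [exact Htau | lra | ].
  intros t Ht; unfold ae; now rewrite Rabs_pos_eq by lra.
Qed.

Lemma angle_acute (tau t : R) : 0 < t < tau -> 0 < angle tau t < PI / 2.
Proof.
  intros Ht; pose proof (angle_bounds tau t ltac:(lra) ltac:(lra)) as Hw.
  split; [lra | apply Rnot_le_lt; intros Hle].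
  pose proof (cos_angle tau t ltac:(lra) ltac:(lra)) as E.
  rewrite odd_a_pos in E by lra.
  pose proof (a_pos t ltac:(lra)); pose proof (a_pos tau ltac:(lra)).
  assert (cos (angle tau t) <= 0) by (apply cos_le_0; lra); nra.
Qed.

Lemma angle_le_PI2 (tau s : R) : 0 <= s < tau -> 0 < angle tau s <= PI / 2.
Proof.
  intros [[Hs | <-] H]; [pose proof (angle_acute tau s); lra | ].
  rewrite angle_0; pose proof PI_RGT_0; lra.
Qed.

Lemma aphi_at_a (t : R) : 0 < t -> aphi (a t) = hubble_time t /\ apsi (a t) = hubble_time t * (1 - accel t).
Proof.
  intros Ht; unfold apsi, aphi; rewrite even_inv_at_pos by (apply a_pos, Ht).
  rewrite inv_a_a by lra; auto.
Qed.

(** A primitive of the integrand of [f_nonneg] in the angle, where [w0] belongs to the lower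
    endpoint. The factor [(1 - sin w0 * sin w) / cos w] is a primitive of
    [(sin w - sin w0) / cos w ^ 2]; the psi terms of the integration by parts then collapse, by
    [1 - sin w ^ 2 = cos w ^ 2], to [sin w0 * apsi (A * cos w)], the integrand of [sin w0 * J]. *)
Definition f_primitive (A w0 w : R) : R :=
  (sin w0 * J A w + aphi (A * cos w) * ((1 - sin w0 * sin w) / cos w)) / A.

Lemma f_primitive_derive (A w0 w : R) : 0 < A -> 0 < w < PI / 2 ->
  is_derive (f_primitive A w0) w
    ((aphi (A * cos w) - apsi (A * cos w)) * (sin w - sin w0) / (A * cos w ^ 2)).
Proof.
  intros HA Hw; assert (Hc : 0 < cos w) by (apply cos_gt_0; lra).
  pose proof (sin2_cos2 w) as E; unfold Rsqr in E.
  apply (is_derive_ext (fun w => / A * (sin w0 * J A w + aphi (A * cos w) * ((1 - sin w0 * sin w) / cos w)))).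
  { intros u; eqR; apply Rmult_comm. }
  replace ((aphi (A * cos w) - apsi (A * cos w)) * (sin w - sin w0) / (A * cos w ^ 2))
    with (/ A * (sin w0 * apsi (A * cos w) +
      ((- (A * sin w)) * (apsi (A * cos w) / (A * cos w)) * ((1 - sin w0 * sin w) / cos w)
       + aphi (A * cos w) * ((sin w - sin w0) / cos w ^ 2)))).
  2:{ apply (Rmult_eq_reg_r (A * cos w ^ 2)); [ | apply Rgt_not_eq; apply Rmult_lt_0_compat; [lra | apply pow_lt, Hc]].
      replace ((aphi (A * cos w) - apsi (A * cos w)) * (sin w - sin w0) / (A * cos w ^ 2) * (A * cos w ^ 2))
        with ((aphi (A * cos w) - apsi (A * cos w)) * (sin w - sin w0)) by (field; lra).
      transitivity (sin w0 * apsi (A * cos w) * (cos w * cos w)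
        - sin w * apsi (A * cos w) * (1 - sin w0 * sin w) + aphi (A * cos w) * (sin w - sin w0));
        [field; lra | ].
      replace (cos w * cos w) with (1 - sin w * sin w) by lra; ring. }
  apply (is_derive_scal (fun w => sin w0 * J A w + aphi (A * cos w) * ((1 - sin w0 * sin w) / cos w))).
  apply (is_derive_plus (fun w => sin w0 * J A w) (fun w => aphi (A * cos w) * ((1 - sin w0 * sin w) / cos w))).
  - apply (is_derive_scal (J A)), cos_integral_derive, apsi_continuous.
  - apply (is_derive_mult (fun w => aphi (A * cos w)) (fun w => (1 - sin w0 * sin w) / cos w));
      [ | | intros; apply Rmult_comm].
    + apply (is_derive_comp aphi (fun w => A * cos w)).
      * apply aphi_derive; apply Rmult_integral_contrapositive; lra.
      * auto_derive; auto; ring.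
    + auto_derive; [lra | ].
      field_simplify; [ | lra | lra]; f_equal.
      replace (sin w ^ 2) with (1 - cos w ^ 2) by nra; ring.
Qed.

(** The division by [cos w] is harmless below [PI / 2]. The angle [PI / 2] itself is needed only for
    the lower endpoint [t = 0], where [sin w0 = 1] and the quotient becomes
    [cos w / (1 + sin w)]. *)
Lemma f_primitive_continuous (A w0 w : R) : 0 < A -> - PI / 2 < w <= PI / 2 ->
  w < PI / 2 \/ sin w0 = 1 -> continuous (f_primitive A w0) w.
Proof.
  intros HA Hw Hor.
  assert (HJ : continuous (fun w => sin w0 * J A w) w).
  { apply (continuous_scal_r (sin w0) (J A)); eapply continuous_RtoR_of_derive.
    apply cos_integral_derive, apsi_continuous. }
  assert (Hphi : continuous (fun w => aphi (A * cos w)) w).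
  { apply (continuity_2d_pt_section (fun A w => aphi (A * cos w)) A).
    apply continuity_2d_pt_cos_comp, aphi_continuous. }
  apply (continuous_mult (fun w => sin w0 * J A w + aphi (A * cos w) * ((1 - sin w0 * sin w) / cos w))
    (fun _ => / A)); [ | apply continuous_const].
  apply (continuous_plus (fun w => sin w0 * J A w) (fun w => aphi (A * cos w) * ((1 - sin w0 * sin w) / cos w)));
    [exact HJ | ].
  destruct (Rlt_le_dec w (PI / 2)) as [Hlt | Hge].
  - apply (continuous_mult (fun w => aphi (A * cos w)) (fun w => (1 - sin w0 * sin w) / cos w)); [exact Hphi | ].
    assert (0 < cos w) by (apply cos_gt_0; lra).
    apply (ex_derive_continuous (fun w => (1 - sin w0 * sin w) / cos w)); auto_derive; lra.
  - destruct Hor as [Hor | Hor]; [lra | rewrite Hor].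
    assert (w = PI / 2) by lra; subst w.
    apply (continuous_ext_loc _ (fun w => aphi (A * cos w) * (cos w / (1 + sin w)))).
    + generalize (filter_and _ _ (open_gt 0 (PI / 2) (proj1 PI2_bounds)) (open_lt PI (PI / 2) (proj2 PI2_bounds))).
      apply filter_imp; intros u Hu.
      assert (0 < sin u) by (apply sin_gt_0; lra).
      eqR; destruct (Req_dec (cos u) 0) as [E | E].
      * rewrite E, Rmult_0_r, aphi_0; ring.
      * f_equal; pose proof (sin2_cos2 u) as E2; unfold Rsqr in E2.
        apply (Rmult_eq_reg_r (cos u * (1 + sin u))); [ | apply Rmult_integral_contrapositive; lra].
        transitivity (cos u * cos u); [field; lra | ].
        transitivity ((1 - sin u) * (1 + sin u)); [nra | field; lra].
    + apply (continuous_mult (fun w => aphi (A * cos w)) (fun w => cos w / (1 + sin w))); [exact Hphi | ].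
      apply (ex_derive_continuous (fun w => cos w / (1 + sin w))); auto_derive.
      rewrite sin_PI2; lra.
Qed.

Lemma f_primitive_diag (A w : R) : 0 < A ->
  f_primitive A w w = (sin w * J A w + aphi (A * cos w) * cos w) / A.
Proof.
  intros HA; unfold f_primitive; do 2 f_equal.
  destruct (Req_dec (cos w) 0) as [E | E].
  - rewrite E, Rmult_0_r, aphi_0; ring.
  - f_equal; pose proof (sin2_cos2 w) as E2; unfold Rsqr in E2.
    replace (1 - sin w * sin w) with (cos w * cos w) by lra; field; exact E.
Qed.

Lemma f_nonneg_eq (tau s : R) : 0 <= s < tau ->
  1 - da a tau * f_nonneg a tau s = Gam aphi apsi (a tau) (angle tau s).
Proof.
  intros Hs; assert (Htau : 0 < tau) by lra.
  set (A := a tau); set (w0 := angle tau s).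
  assert (HA : 0 < A) by (apply a_pos, Htau).
  pose proof (angle_le_PI2 tau s Hs) as Hw0; fold w0 in Hw0.
  pose proof PI_RGT_0 as HPI.
  assert (Hae : forall t, 0 <= t -> ae a t = a t).
  { intros t Ht; unfold ae; now rewrite Rabs_pos_eq. }
  assert (E : f_nonneg a tau s = f_primitive A w0 0 - f_primitive A w0 w0).
  { unfold f_nonneg.
    apply (iint_primitive _ (fun t => f_primitive A w0 (angle tau t))); [lra | | | ].
    - intros t Ht; pose proof (angle_acute tau t ltac:(lra)) as Hw.
      assert (Hat : 0 < a t) by (apply a_pos; lra).
      assert (Hdt : 0 < da a t) by (apply da_pos; lra).
      assert (Hsin : 0 < sin (angle tau t)) by (apply sin_gt_0; lra).
      assert (Hcos : A * cos (angle tau t) = a t).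
      { unfold A; rewrite cos_angle by lra; apply odd_a_pos; lra. }
      split.
      + replace (dda a t / da a t ^ 2 * (sqrt (a tau ^ 2 - a s ^ 2) / sqrt (a tau ^ 2 - a t ^ 2) - 1))
          with ((- odd_speed t / sqrt (a tau ^ 2 - ae a t ^ 2)) *
            ((aphi (A * cos (angle tau t)) - apsi (A * cos (angle tau t)))
              * (sin (angle tau t) - sin w0) / (A * cos (angle tau t) ^ 2))).
        * apply (is_derive_comp (f_primitive A w0) (angle tau)).
          -- apply f_primitive_derive; auto.
          -- apply angle_derive; lra.
        * rewrite Hcos; destruct (aphi_at_a t) as [-> ->]; [lra | ].
          rewrite <- (Hae s), <- (Hae t) by lra.
          rewrite <- !sin_angle by lra; fold A w0.
          unfold odd_speed; destruct (Req_dec_T t 0); [lra | ].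
          rewrite Rabs_pos_eq by lra.
          replace (cos (angle tau t)) with (a t / A) by (rewrite <- Hcos; field; lra).
          unfold hubble_time, accel; field; repeat split; lra.
      + apply (continuous_mult (fun t => dda a t / da a t ^ 2)
          (fun t => sqrt (a tau ^ 2 - a s ^ 2) / sqrt (a tau ^ 2 - a t ^ 2) - 1)).
        * apply (ex_derive_continuous (fun t => dda a t / da a t ^ 2)).
          eexists; apply (is_derive_div (dda a) (fun t => da a t ^ 2)).
          -- apply dda_derive; lra.
          -- apply (is_derive_comp (fun y => y ^ 2) (da a)); [ | apply da_derive; lra].
             auto_derive; auto.
          -- apply pow_nonzero; lra.
        * apply (continuous_minus _ (fun _ => 1)); [ | apply continuous_const].
          apply (continuous_scal_r (sqrt (a tau ^ 2 - a s ^ 2)) (fun t => / sqrt (a tau ^ 2 - a t ^ 2))).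
          apply (continuous_of_interior_eq (fun t => / sqrt (a tau ^ 2 - ae a t ^ 2)) _ s tau); auto.
          { intros u Hu; now rewrite Hae by lra. }
          apply inv_sqrt_gap_continuous; lra.
    - apply (filterlim_at_right_of_continuous (fun t => f_primitive A w0 (angle tau t))).
      apply (continuous_comp (angle tau) (f_primitive A w0)).
      + eapply continuous_RtoR_of_derive, angle_derive; lra.
      + fold w0; apply f_primitive_continuous; [exact HA | lra | ].
        destruct (proj2 Hw0) as [H | H]; [now left | right; rewrite H; apply sin_PI2].
    - apply (filterlim_comp _ _ _ (angle tau) (f_primitive A w0) _ (locally 0));
        [apply angle_left_limit, Htau | ].
      apply f_primitive_continuous; lra. }
  (* At angle 0 the primitive is [aphi A / A = / da a tau], which cancels the leading 1; the
     diagonal value is multiplied by [da a tau], and [da a tau / A = / aphi A]. *)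
  rewrite E, f_primitive_diag by exact HA.
  destruct (aphi_at_a tau Htau) as [Eh _]; fold A in Eh; unfold hubble_time in Eh; fold A in Eh.
  pose proof (da_pos tau Htau) as Hd.
  unfold f_primitive, J, Jint; rewrite cos_integral_0, sin_0, cos_0.
  unfold Gam, Gnum, corr; destruct (Rle_dec w0 (PI / 2)); [ | lra].
  rewrite !Rmult_1_r, Eh; unfold Jint; field; lra.
Qed.

Lemma fF_eq (tau s : R) : - tau < s < tau ->
  1 - da a tau * fF a tau s = Gam aphi apsi (a tau) (angle tau s).
Proof.
  intros Hs; unfold fF; destruct (Rle_dec 0 s) as [H | H]; [apply f_nonneg_eq; lra | ].
  assert (Htau : 0 < tau) by lra.
  pose proof (angle_acute tau (- s) ltac:(lra)) as Hw; rewrite angle_opp in Hw.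
  replace (1 - da a tau * (2 * f_nonneg a tau 0 - f_nonneg a tau (- s)))
    with (2 * (1 - da a tau * f_nonneg a tau 0) - (1 - da a tau * f_nonneg a tau (- s))) by ring.
  rewrite !f_nonneg_eq by lra; rewrite angle_0, angle_opp.
  assert (0 < aphi (a tau)) by (apply aphi_pos, Rgt_not_eq, a_pos, Htau).
  set (w := angle tau s) in *; unfold Gam, Gnum, corr.
  destruct (Rle_dec (PI / 2) (PI / 2)), (Rle_dec (PI - w) (PI / 2)), (Rle_dec w (PI / 2)); try lra.
  unfold Jint; rewrite cos_integral_reflect.
  - replace (cos (PI - w)) with (- cos w) by (rewrite cos_minus, cos_PI, sin_PI; ring).
    rewrite sin_PI_x, cos_PI2, sin_PI2.
    replace (aphi (a tau * - cos w)) with (aphi (a tau * cos w)).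
    + field; lra.
    + unfold aphi; rewrite <- even_inv_opp; do 2 f_equal; ring.
  - apply apsi_continuous.
  - intros y; unfold apsi, aphi; now rewrite even_inv_opp.
Qed.

(** * The angle as a function of tau and rho *)

Lemma inD_iff (tau rho : R) : inD a tau rho <-> 0 < tau /\ 0 < rho < P (a tau) PI.
Proof.
  unfold inD; split; intros [Htau H]; split; auto; revert H;
    rewrite rhoM_eq by exact Htau; unfold P; rewrite (Pint_PI _ _ _ a_profile); tauto.
Qed.

Lemma angle_surjective (tau w : R) : 0 < tau -> 0 < w < PI ->
  exists s, - tau < s < tau /\ angle tau s = w.
Proof.
  intros Htau Hw; pose proof (a_pos tau Htau) as HA.
  assert (Hsmall : forall c, 0 <= c < 1 -> exists s, 0 <= s < tau /\ odd_a s = a tau * c).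
  { intros c Hc; assert (0 <= a tau * c < a tau) by nra.
    destruct (inv_a_spec (a tau * c)) as [H1 H2]; [lra | ].
    exists (inv_a (a tau * c)); split; [split; [exact H1 | apply inv_a_lt; lra] | ].
    now rewrite odd_a_pos. }
  assert (Hc : -1 < cos w < 1).
  { split.
    - rewrite <- cos_PI; apply cos_decreasing_1; lra.
    - rewrite <- cos_0; apply cos_decreasing_1; lra. }
  assert (exists s, - tau < s < tau /\ odd_a s = a tau * cos w) as [s [Hs E]].
  { destruct (Rle_lt_dec 0 (cos w)).
    - destruct (Hsmall (cos w)) as [s [Hs E]]; [lra | exists s; split; [lra | exact E]].
    - destruct (Hsmall (- cos w)) as [s [Hs E]]; [lra | ].
      exists (- s); split; [lra | rewrite odd_a_opp, E; ring]. }
  exists s; split; [exact Hs | ].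
  unfold angle; rewrite E.
  replace (a tau * cos w / a tau) with (cos w) by (field; lra).
  apply acos_cos; lra.
Qed.

Lemma P_derive (A w : R) : is_derive (P A) w (aphi (A * cos w)).
Proof. apply cos_integral_derive, aphi_continuous. Qed.

Lemma t0_spec (tau rho : R) : inD a tau rho ->
  - tau < t0 a tau rho < tau /\ rho = rho_of a tau (t0 a tau rho).
Proof.
  intros HD; apply inD_iff in HD; destruct HD as [Htau Hrho].
  unfold t0; apply epsilon_spec.
  assert (HP0 : P (a tau) 0 = 0) by apply cos_integral_0.
  (* The angle is found first and then pulled back to a time. As [rho] lies strictly between the end
     values of [P (a tau)], neither 0 nor [PI] can occur. *)
  destruct (IVT_gen (P (a tau)) 0 PI rho) as [w [Hw E]].
  - intros w; apply continuity_pt_filterlim; eapply continuous_RtoR_of_derive, P_derive.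
  - rewrite HP0, Rmin_left, Rmax_right; lra.
  - pose proof PI_RGT_0; rewrite Rmin_left, Rmax_right in Hw by lra.
    assert (w <> 0) by (intros ->; lra).
    assert (w <> PI) by (intros ->; lra).
    destruct (angle_surjective tau w Htau) as [s [Hs Es]]; [lra | ].
    exists s; split; [exact Hs | rewrite rho_of_eq, Es by lra; auto].
Qed.

Definition angle_of (tau rho : R) : R := angle tau (t0 a tau rho).

Lemma angle_of_spec (tau rho : R) : inD a tau rho ->
  0 < angle_of tau rho < PI /\ P (a tau) (angle_of tau rho) = rho.
Proof.
  intros HD; destruct (t0_spec tau rho HD) as [Hs E]; destruct HD as [Htau _].
  split; [apply angle_bounds; auto | ].
  rewrite rho_of_eq in E by auto; now symmetry.
Qed.

Lemma g_tautau_eq (tau rho : R) : inD a tau rho ->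
  g_tautau a tau rho = - Gam aphi apsi (a tau) (angle_of tau rho) ^ 2.
Proof.
  intros HD; unfold g_tautau; rewrite fF_eq; [reflexivity | apply t0_spec, HD].
Qed.

Lemma P_a_continuous (tau w : R) : 0 < tau -> continuous (fun s => P (a s) w) tau.
Proof.
  intros Htau; apply (continuous_comp a (fun A => P A w)).
  - eapply continuous_RtoR_of_derive, a_derive, Htau.
  - apply (continuity_2d_pt_section_l P).
    apply cos_integral_continuous; [apply aphi_continuous | apply a_pos, Htau].
Qed.

(** Monotonicity alone gives this: [rho] lies strictly between the values of [P (a tau)] at [w - e']
    and [w + e'], the gap survives small changes of tau and rho, and strict monotonicity of
    [P (a tau')] traps the new angle. Nothing is divided by the w-derivative of [P], so [w = PI / 2]
    is included. *)
Lemma angle_of_continuous (tau rho : R) : inD a tau rho -> forall e, 0 < e ->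
  exists d, 0 < d /\ forall tau' rho', inD a tau' rho' ->
    Rabs (tau' - tau) < d -> Rabs (rho' - rho) < d ->
    Rabs (angle_of tau' rho' - angle_of tau rho) < e.
Proof.
  intros HD e He; pose proof HD as [Htau _].
  destruct (angle_of_spec tau rho HD) as [Hw Er]; set (w := angle_of tau rho) in *.
  set (e' := Rmin e (Rmin w (PI - w)) / 2).
  assert (He' : 0 < e' /\ e' < e /\ e' < w /\ e' < PI - w).
  { pose proof (Rmin_l e (Rmin w (PI - w))); pose proof (Rmin_r e (Rmin w (PI - w))).
    pose proof (Rmin_l w (PI - w)); pose proof (Rmin_r w (PI - w)).
    assert (0 < Rmin e (Rmin w (PI - w))) by (repeat apply Rmin_pos; lra).
    unfold e'; lra. }
  pose proof (Pint_strict _ _ _ a_profile) as Hinc; fold P in Hinc.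
  pose proof (a_pos tau Htau) as HA.
  assert (L1 : P (a tau) (w - e') < rho) by (rewrite <- Er; apply Hinc; lra).
  assert (L2 : rho < P (a tau) (w + e')) by (rewrite <- Er; apply Hinc; lra).
  (* Half the gap: one [m] absorbs the change of [P] with tau, the other the change of rho. *)
  set (m := Rmin (rho - P (a tau) (w - e')) (P (a tau) (w + e') - rho) / 2).
  assert (Hm : 0 < m /\ P (a tau) (w - e') + 2 * m <= rho /\ rho + 2 * m <= P (a tau) (w + e')).
  { unfold m; pose proof (Rmin_l (rho - P (a tau) (w - e')) (P (a tau) (w + e') - rho)).
    pose proof (Rmin_r (rho - P (a tau) (w - e')) (P (a tau) (w + e') - rho)).
    assert (0 < Rmin (rho - P (a tau) (w - e')) (P (a tau) (w + e') - rho)) by (apply Rmin_pos; lra).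
    lra. }
  destruct Hm as (Hm & M1 & M2).
  destruct (proj1 (filterlim_locally _ _) (P_a_continuous tau (w - e') Htau) (mkposreal m Hm)) as [d1 H1].
  destruct (proj1 (filterlim_locally _ _) (P_a_continuous tau (w + e') Htau) (mkposreal m Hm)) as [d2 H2].
  exists (Rmin m (Rmin d1 d2)); split; [repeat apply Rmin_pos; auto; apply cond_pos | ].
  intros tau' rho' HD' Ht Hr.
  apply Rmin_Rgt_l in Ht; destruct Ht as [_ Ht]; apply Rmin_Rgt_l in Ht; destruct Ht as [T1 T2].
  apply Rmin_Rgt_l in Hr; destruct Hr as [Hr _].
  specialize (H1 tau' T1); specialize (H2 tau' T2).
  change (Rabs (P (a tau') (w - e') - P (a tau) (w - e')) < m) in H1.
  change (Rabs (P (a tau') (w + e') - P (a tau) (w + e')) < m) in H2.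
  apply Rgt_lt, Rabs_def2 in Hr; apply Rabs_def2 in H1; apply Rabs_def2 in H2.
  destruct (angle_of_spec tau' rho' HD') as [Hw' Er']; set (w' := angle_of tau' rho') in *.
  pose proof (a_pos tau' (proj1 HD')) as HA'.
  assert (w - e' < w').
  { apply Rnot_le_lt; intros [Hle | Hle].
    - pose proof (Hinc (a tau') w' (w - e') HA' ltac:(lra) Hle ltac:(lra)); lra.
    - rewrite Hle in Er'; lra. }
  assert (w' < w + e').
  { apply Rnot_le_lt; intros [Hle | Hle].
    - pose proof (Hinc (a tau') (w + e') w' HA' ltac:(lra) Hle ltac:(lra)); lra.
    - rewrite <- Hle in Er'; lra. }
  apply Rabs_def1; lra.
Qed.

Lemma inD_open_l (tau rho : R) : inD a tau rho -> locally tau (fun s => inD a s rho).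
Proof.
  intros HD; apply inD_iff in HD; destruct HD as [Htau [H1 H2]].
  assert (L : locally tau (fun s => rho < P (a s) PI)).
  { exact (P_a_continuous tau PI Htau _ (open_gt rho _ H2)). }
  generalize (filter_and _ _ (locally_pos tau Htau) L).
  apply filter_imp; intros s [Hs1 Hs2]; apply inD_iff; auto.
Qed.

(** * The partial derivative in tau and its continuity *)

Definition g_slope (tau w : R) : R :=
  - (2 * Gam aphi apsi (a tau) w *
     (da a tau * (Gam_dx aphi apsi (a tau) w -
        Gratio aphi apsi akappa (a tau) w * (J (a tau) w / a tau)))).

Lemma g_tautau_derive (tau rho : R) : inD a tau rho ->
  is_derive (fun s => g_tautau a s rho) tau (g_slope tau (angle_of tau rho)).
Proof.
  intros HD; pose proof HD as [Htau _].
  destruct (angle_of_spec tau rho HD) as [Hw Er].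
  pose proof (a_pos tau Htau) as HA.
  apply (is_derive_ext_loc (fun s => - Gam aphi apsi (a s) (angle_of s rho) ^ 2)).
  { generalize (inD_open_l tau rho HD); apply filter_imp; intros s Hs.
    symmetry; apply g_tautau_eq, Hs. }
  unfold g_slope; set (w := angle_of tau rho) in *.
  set (v := da a tau * _).
  replace (- (2 * Gam aphi apsi (a tau) w * v)) with (v * (- (2 * Gam aphi apsi (a tau) w))) by ring.
  apply (is_derive_comp (fun y => - y ^ 2) (fun s => Gam aphi apsi (a s) (angle_of s rho))).
  { fold w; auto_derive; auto; ring. }
  (* As [s] varies at fixed [rho], the angle moves so that [P] keeps the value [rho]; it enters only
     through its continuity. *)
  apply (is_derive_along_level_set (Gam aphi apsi) P (Gratio aphi apsi akappa)
    (fun A w => aphi (A * cos w)) a (fun s => angle_of s rho) tau rho _ _ _ 0 PI).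
  - intros A w' HA' Hw'; split; [apply (Gam_derive _ _ _ a_profile); auto | ].
    split; [apply P_derive | ].
    destruct (Req_dec (A * cos w') 0) as [-> | H0]; [rewrite aphi_0; lra | ].
    left; apply aphi_pos, H0.
  - exact HA.
  - apply (Gratio_continuous _ _ _ a_profile); auto.
  - apply (Gam_derive_l _ _ _ a_profile); auto.
  - apply (Pint_derive_l _ _ _ a_profile); auto.
  - apply a_derive, Htau.
  - apply filterlim_locally; intros eps.
    destruct (angle_of_continuous tau rho HD eps (cond_pos eps)) as [d [Hd HB]].
    assert (L : locally tau (fun s => Rabs (s - tau) < d)).
    { exists (mkposreal d Hd); auto. }
    generalize (filter_and _ _ L (inD_open_l tau rho HD)).
    apply filter_imp; intros s [Hs1 Hs2]; apply HB; auto.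
    rewrite Rminus_eq_0, Rabs_R0; exact Hd.
  - generalize (inD_open_l tau rho HD); apply filter_imp; intros s Hs.
    apply angle_of_spec, Hs.
Qed.

Lemma g_slope_continuous (tau w : R) : 0 < tau -> 0 < w < PI ->
  continuity_2d_pt g_slope tau w.
Proof.
  intros Htau Hw; pose proof (a_pos tau Htau) as HA.
  assert (Ha : continuous a tau) by (eapply continuous_RtoR_of_derive, a_derive, Htau).
  assert (Hcomp : forall f, continuity_2d_pt f (a tau) w ->
    continuity_2d_pt (fun tau w => f (a tau) w) tau w).
  { intros f Hf; apply (continuity_2d_pt_comp2 f (fun tau _ => a tau) (fun _ w => w)); auto.
    - apply (continuity_2d_pt_comp1 a (fun tau _ => tau)); [exact Ha | apply continuity_2d_pt_id1].
    - apply continuity_2d_pt_id2. }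
  apply continuity_2d_pt_opp, continuity_2d_pt_mult.
  - apply continuity_2d_pt_mult; [apply continuity_2d_pt_const | ].
    apply Hcomp, (Gam_continuous _ _ _ a_profile); auto.
  - apply continuity_2d_pt_mult.
    + apply (continuity_2d_pt_comp1 (da a) (fun tau _ => tau)); [apply da_continuous, Htau | apply continuity_2d_pt_id1].
    + apply (Hcomp (fun A w => Gam_dx aphi apsi A w - Gratio aphi apsi akappa A w * (J A w / A))).
      apply continuity_2d_pt_minus; [apply (Gam_dx_continuous _ _ _ a_profile); auto | ].
      apply continuity_2d_pt_mult; [apply (Gratio_continuous _ _ _ a_profile); auto | ].
      apply continuity_2d_pt_mult; [apply (Jint_continuous _ _ _ a_profile); auto | ].
      apply continuity_2d_pt_inv; [apply continuity_2d_pt_id1 | lra].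
Qed.

Lemma g_slope_along_continuous (tau rho e : R) : inD a tau rho -> 0 < e ->
  exists d, 0 < d /\ forall tau' rho', inD a tau' rho' ->
    Rabs (tau' - tau) < d -> Rabs (rho' - rho) < d ->
    Rabs (g_slope tau' (angle_of tau' rho') - g_slope tau (angle_of tau rho)) < e.
Proof.
  intros HD He.
  destruct (g_slope_continuous tau (angle_of tau rho) (proj1 HD)
    (proj1 (angle_of_spec tau rho HD)) (mkposreal e He)) as [d1 H1].
  destruct (angle_of_continuous tau rho HD d1 (cond_pos d1)) as [d2 [Hd2 H2]].
  exists (Rmin d1 d2); split; [apply Rmin_pos; auto; apply cond_pos | ].
  intros tau' rho' HD' Ht Hr.
  apply Rmin_Rgt_l in Ht; apply Rmin_Rgt_l in Hr.
  apply H1; [apply Ht | apply H2; auto; [apply Ht | apply Hr]].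
Qed.

End ScaleFactor.

Theorem theorem5p13 (a : R -> R) :
  strongly_regular_scale_factor a ->
  (forall t, 0 < t -> ex_derive (dda a) t) ->
  (exists C, 0 < C /\ forall t, 0 < t ->
     Rabs (ddda a t * a t ^ 2 / (da a t) ^ 3) <= C) ->
  ((filterlim (da a) (at_right 0) (locally 0) /\
      exists eps, 0 < eps /\ forall t, 0 < t < eps -> 0 <= dda a t)
   \/ (exists l, 0 < l /\ filterlim (da a) (at_right 0) (locally l))) ->
  exists h : R -> R -> R,
    (forall tau rho, inD a tau rho ->
       is_derive (fun s => g_tautau a s rho) tau (h tau rho)) /\
    (forall tau rho, inD a tau rho ->
       forall e, 0 < e -> exists d, 0 < d /\
         forall tau' rho', inD a tau' rho' ->
           Rabs (tau' - tau) < d -> Rabs (rho' - rho) < d ->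
           Rabs (h tau' rho' - h tau rho) < e).
Proof.
  intros [Hreg [K [_ Hlower]]] Hex [C [_ Hthird]] Hspeed.
  (* Either alternative supplies a finite limit of a' at 0 from the right, with value 0 in the
     first. *)
  assert (exists l, filterlim (da a) (at_right 0) (locally l)) as [l Hl].
  { destruct Hspeed as [[H _] | [l [_ H]]]; eexists; exact H. }
  exists (fun tau rho => g_slope a l tau (angle_of a tau rho)); split.
  - intros tau rho HD; apply (g_tautau_derive a Hreg K C l); assumption.
  - intros tau rho HD e He; apply (g_slope_along_continuous a Hreg K C l); assumption.
Qed.
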